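(* Let $p$ be a prime number and let $K$ be a local or global field containing a primitive $p$-th root of unity. Let $a,b,c\in K^\times$ and assume that the classes $[a],[b],[c]$ in the $\mathbb{F}_p$-vector space $K^\times/(K^\times)^p$ are linearly independent. Assume further that $\chi_a\cup\chi_b=\chi_b\cup\chi_c=0$ in $H^2(G_K,\mathbb{F}_p)$. Then the Galois extension $K(\sqrt[p]{a},\sqrt[p]{b},\sqrt[p]{c})/K$ can be embedded in a $\mathbb{U}_4(\mathbb{F}_p)$-Galois extension $L/K$; that is, there is a Galois extension $L/K$ with $\mathrm{Gal}(L/K)\cong \mathbb{U}_4(\mathbb{F}_p)$ and $K(\sqrt[p]{a},\sqrt[p]{b},\sqrt[p]{c})\subseteq L$.
   Context: A global field is a finite extension of $\mathbb{Q}$ or a function field in one variable over a finite field; local fields include the archimedean ones $\mathbb{R}$ and $\mathbb{C}$. $G_K$ denotes the absolute Galois group of $K$. A primitive $p$-th root of unity $\zeta_p\in K$ is fixed. For $a\in K^\times$, $\chi_a\in H^1(G_K,\mathbb{F}_p)$ is the Kummer character given by $\sigma(\sqrt[p]{a})=\zeta_p^{\chi_a(\sigma)}\sqrt[p]{a}$ for all $\sigma\in G_K$. $\mathbb{U}_4(\mathbb{F}_p)$ is the group of upper-triangular unipotent $4\times 4$ matrices with entries in $\mathbb{F}_p$. *)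

(* Defs.v *)
From HB Require Import structures.
From mathcomp Require Import all_boot all_order all_algebra all_fingroup.
From mathcomp Require Import all_field generic_quotient ring_quotient.
From mathcomp Require Import boolp classical_sets functions reals topology.
From mathcomp Require Import complex ring.

Set Implicit Arguments.
Unset Strict Implicit.
Unset Printing Implicit Defensive.

Import Order.TTheory GRing.Theory Num.Theory.

Local Open Scope ring_scope.

Definition field_isomorphic (E F : fieldType) : Prop :=
  exists f : {rmorphism E -> F}, bijective f.

Definition number_field (K : fieldType) : Prop :=
  exists L : fieldExtType rat, field_isomorphic L K.

Definition function_field (K : fieldType) : Prop :=
  exists (F : finFieldType) (L : fieldExtType {fraction {poly F}}),
    field_isomorphic L K.

Definition global_field (K : fieldType) : Prop :=
  number_field K \/ function_field K.

(* A normalized discrete valuation; v 0 = +oo is encoded by leaving v 0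
   unconstrained and testing valuations only through val_ge below. *)
Record discrete_valuation (K : fieldType) (v : K -> int) : Prop := {
  valuationM : forall x y, x != 0 -> y != 0 -> v (x * y) = v x + v y;
  valuationD : forall x y, x != 0 -> y != 0 -> x + y != 0 ->
    Num.min (v x) (v y) <= v (x + y);
  valuation_surj : forall n : int, exists2 x, x != 0 & v x = n }.

Definition val_ge (K : fieldType) (v : K -> int) (n : int) (x : K) : bool :=
  (x == 0) || (n <= v x).

Definition val_complete (K : fieldType) (v : K -> int) : Prop :=
  forall u : nat -> K,
    (forall n : int, exists N : nat, forall i j : nat,
        (N <= i)%N -> (N <= j)%N -> val_ge v n (u i - u j)) ->
    exists l : K, forall n : int, exists N : nat, forall i : nat,
        (N <= i)%N -> val_ge v n (u i - l).

(* The residue ring {v >= 0} / {v >= 1} is finite: s represents its classes. *)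
Definition finite_residue_field (K : fieldType) (v : K -> int) : Prop :=
  exists s : seq K, forall x, val_ge v 0 x ->
    exists2 y, y \in s & val_ge v 0 y && val_ge v 1 (x - y).

Definition nonarchimedean_local_field (K : fieldType) : Prop :=
  exists v : K -> int,
    [/\ discrete_valuation v, val_complete v & finite_residue_field v].

Definition archimedean_local_field (K : fieldType) : Prop :=
  exists R : realType, field_isomorphic R K \/ field_isomorphic R[i] K.

Definition local_field (K : fieldType) : Prop :=
  nonarchimedean_local_field K \/ archimedean_local_field K.

(* Written multiplicatively: the class of prod_i (u i)^(k i) is the linear
   combination of the classes [u i] with coefficients k i. *)
Definition free_mod_powers (p : nat) (K : fieldType) (n : nat)
    (u : 'I_n -> K) : Prop :=
  forall k : 'I_n -> 'F_p,
    (exists2 d : K, d != 0 & \prod_i u i ^+ k i = d ^+ p) ->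
    forall i, k i = 0.

HB.mixin Record isTopGroup G & monoid.Group G & Topological G := {
  mulg_continuous : continuous (fun st : G * G => (st.1 * st.2)%g);
  invg_continuous : continuous (fun s : G => s^-1%g) }.

#[short(type="topGroupType")]
HB.structure Definition TopGroup :=
  {G of isTopGroup G & monoid.Group G & Topological G}.

Lemma continuous_discrete (T : topologicalType) (D : choiceType)
    (f : T -> discrete_topology D) :
  continuous f <-> forall t, nbhs t [set u | f u = f t]%classic.
Proof.
split=> [cf t|h t A]; first exact: (cf t [set y | y = f t]%classic).
by rewrite /nbhs /= => /= Af; apply: filterS (h t) => u /= ->; apply: Af.
Qed.

Section Cohomology.
Variables (p : nat) (G : topGroupType).

(* F_p carries the discrete topology. *)
Definition continuous_cochain (T : topologicalType) (f : T -> 'F_p) : Prop :=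
  continuous (f : T -> discrete_topology 'F_p).

Lemma continuous_cochain_op (T : topologicalType) (f g : T -> 'F_p)
    (op : 'F_p -> 'F_p -> 'F_p) :
  continuous_cochain f -> continuous_cochain g ->
  continuous_cochain (fun t => op (f t) (g t)).
Proof.
move=> /continuous_discrete cf /continuous_discrete cg.
apply/continuous_discrete => t.
by apply: filterS2 (cf t) (cg t) => u /= -> ->.
Qed.

Lemma continuous_cochain_cst (T : topologicalType) (c : 'F_p) :
  continuous_cochain (fun _ : T => c).
Proof. by apply/continuous_discrete => t; apply: filterE. Qed.

(* H^1: since G acts trivially on F_p there are no nonzero 1-coboundaries, and
   H^1 is the group of 1-cocycles, i.e. of continuous homomorphisms. *)
Definition cocycle1 : {pred G -> 'F_p} := fun f =>
  `[< continuous_cochain f /\ forall s t : G, f (s * t)%g = f s + f t >].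

Lemma cocycle1_zmod_closed : zmod_closed cocycle1.
Proof.
split.
  apply/asboolP; split=> [|s t]; first exact: continuous_cochain_cst.
  by rewrite /= addr0.
move=> f g /asboolP[cf hf] /asboolP[cg hg]; apply/asboolP; split=> [|s t].
  exact: (continuous_cochain_op (op := fun x y => x - y) cf cg).
by rewrite !fctE hf hg opprD addrACA.
Qed.
HB.instance Definition _ :=
  GRing.isZmodClosed.Build (G -> 'F_p) cocycle1 cocycle1_zmod_closed.

Record H1 := Cocycle1 { H1val :> G -> 'F_p; _ : H1val \in cocycle1 }.
HB.instance Definition _ := [isSub for H1val].
HB.instance Definition _ := [Choice of H1 by <:].
HB.instance Definition _ := [SubChoice_isSubZmodule of H1 by <:].

Lemma H1P (f : H1) :
  continuous_cochain f /\ forall s t : G, f (s * t)%g = f s + f t.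
Proof. exact/asboolP/(valP f). Qed.

Definition coboundary1 (f : G -> 'F_p) : G * G -> 'F_p :=
  fun st => f st.2 - f (st.1 * st.2)%g + f st.1.

Definition cocycle2 : {pred G * G -> 'F_p} := fun f =>
  `[< continuous_cochain f /\ forall s t u : G,
      f (t, u) - f ((s * t)%g, u) + f (s, (t * u)%g) - f (s, t) = 0 >].

Lemma cocycle2_zmod_closed : zmod_closed cocycle2.
Proof.
split.
  apply/asboolP; split=> [|s t u]; first exact: continuous_cochain_cst.
  by rewrite /= !subr0 addr0.
move=> f g /asboolP[cf hf] /asboolP[cg hg]; apply/asboolP; split=> [|s t u].
  exact: (continuous_cochain_op (op := fun x y => x - y) cf cg).
have sub4 (a b c d a' b' c' d' : 'F_p) :
    (a - a') - (b - b') + (c - c') - (d - d') =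
    (a - b + c - d) - (a' - b' + c' - d') by ring.
by rewrite !fctE sub4 hf hg subrr.
Qed.
HB.instance Definition _ :=
  GRing.isZmodClosed.Build (G * G -> 'F_p) cocycle2 cocycle2_zmod_closed.

Record Z2 := Cocycle2 { Z2val :> G * G -> 'F_p; _ : Z2val \in cocycle2 }.
HB.instance Definition _ := [isSub for Z2val].
HB.instance Definition _ := [Choice of Z2 by <:].
HB.instance Definition _ := [SubChoice_isSubZmodule of Z2 by <:].

Definition B2 : {pred Z2} := fun z =>
  `[< exists2 f : G -> 'F_p, continuous_cochain f & \val z = coboundary1 f >].

Lemma B2_zmod_closed : zmod_closed B2.
Proof.
split.
  apply/asboolP; exists (fun=> 0); first exact: continuous_cochain_cst.
  by apply/funext => st; rewrite /coboundary1 subrr addr0 raddf0.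
move=> z w /asboolP[f cf zf] /asboolP[g cg wg]; apply/asboolP.
exists (fun s => f s - g s).
  exact: (continuous_cochain_op (op := fun x y => x - y) cf cg).
apply/funext => st; rewrite raddfB /= zf wg !fctE /coboundary1.
by rewrite !opprD !opprK !addrA (ACl (1*4*2*5*3*6)).
Qed.
HB.instance Definition _ := GRing.isZmodClosed.Build Z2 B2 B2_zmod_closed.

Definition H2 : zmodType := Quotient.quot B2.

Definition cup_fun (f g : H1) : G * G -> 'F_p := fun st => f st.1 * g st.2.

Lemma cup_fun_cocycle (f g : H1) : cup_fun f g \in cocycle2.
Proof.
have [cf hf] := H1P f; have [cg hg] := H1P g.
apply/asboolP; split=> [|s t u]; rewrite /cup_fun /=.
  apply/continuous_discrete => -[s t].
  move: cf cg => /continuous_discrete cf /continuous_discrete cg.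
  exists ([set s' | f s' = f s], [set t' | g t' = g t])%classic; first by split=> /=.
  by case=> s' t' /= [-> ->].
by rewrite hf hg; ring.
Qed.

Definition cup_cocycle (f g : H1) : Z2 := Cocycle2 (cup_fun_cocycle f g).

Definition cup (f g : H1) : H2 := \pi_(Quotient.quot B2)%qT (cup_cocycle f g).

End Cohomology.

Arguments cup {p G} f g.

Record separable_closure (K Ks : fieldType) (iota : {rmorphism K -> Ks}) :
    Prop := {
  sepclosure_algebraic : forall x : Ks, exists2 q : {poly K},
    separable_poly q & root (map_poly iota q) x;
  sepclosure_closed : forall q : {poly Ks},
    separable_poly q -> (1 < size q)%N -> exists x, root q x }.

Section AbsoluteGaloisGroup.
Variables (K Ks : fieldType) (iota : {rmorphism K -> Ks}).

Definition is_Kaut : {pred Ks -> Ks} := fun f =>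
  `[< [/\ zmod_morphism f, monoid_morphism f, bijective f
        & forall x, f (iota x) = iota x] >].

Record absgal := AbsGal { absgal_fun :> Ks -> Ks; _ : absgal_fun \in is_Kaut }.
HB.instance Definition _ := [isSub for absgal_fun].
HB.instance Definition _ := [Choice of absgal by <:].

Implicit Types s t : absgal.

Lemma absgalP s : [/\ zmod_morphism s, monoid_morphism s, bijective s
                    & forall x, s (iota x) = iota x].
Proof. exact/asboolP/(valP s). Qed.

Lemma absgal_eqP s t : (s : Ks -> Ks) =1 t -> s = t.
Proof. by move=> st; apply/val_inj/funext. Qed.

Lemma id_Kaut : id \in is_Kaut.
Proof. by apply/asboolP; split=> //; exists id. Qed.

Lemma comp_Kaut s t : (s \o t) \in is_Kaut.
Proof.
have [sB [s1 sM] sb sK] := absgalP s; have [tB [t1 tM] tb tK] := absgalP t.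
apply/asboolP; split=> [x y||| x] /=.
- by rewrite tB sB.
- by split=> [|x y] /=; rewrite ?t1 ?s1 // tM sM.
- exact: bij_comp.
- by rewrite tK sK.
Qed.

Lemma inv_Kaut_subproof s : exists t : absgal, cancel s t /\ cancel t s.
Proof.
have [sB [s1 sM] [f sf fs] sK] := absgalP s.
suff fP : f \in is_Kaut by exists (AbsGal fP).
apply/asboolP; split=> [x y||| x].
- by apply: (can_inj sf); rewrite sB !fs.
- by split=> [|x y]; apply: (can_inj sf); rewrite ?sM !fs ?s1.
- by exists s.
- by apply: (can_inj sf); rewrite fs sK.
Qed.

Definition absgal_one : absgal := AbsGal id_Kaut.
Definition absgal_mul s t : absgal := AbsGal (comp_Kaut s t).
Definition absgal_inv s : absgal := projT1 (cid (inv_Kaut_subproof s)).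

Lemma absgal_invK s : cancel s (absgal_inv s).
Proof. by case: (projT2 (cid (inv_Kaut_subproof s))). Qed.

Lemma absgal_invVK s : cancel (absgal_inv s) s.
Proof. by case: (projT2 (cid (inv_Kaut_subproof s))). Qed.

Lemma absgal_mulA : associative absgal_mul.
Proof. by move=> s t u; apply: absgal_eqP. Qed.
Lemma absgal_mul1 : left_id absgal_one absgal_mul.
Proof. by move=> s; apply: absgal_eqP. Qed.
Lemma absgal_mulr1 : right_id absgal_one absgal_mul.
Proof. by move=> s; apply: absgal_eqP. Qed.
Lemma absgal_mulV : left_inverse absgal_one absgal_inv absgal_mul.
Proof. by move=> s; apply: absgal_eqP => x /=; rewrite absgal_invK. Qed.
Lemma absgal_mulrV : right_inverse absgal_one absgal_inv absgal_mul.
Proof. by move=> s; apply: absgal_eqP => x /=; rewrite absgal_invVK. Qed.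

HB.instance Definition _ := isGroup.Build absgal absgal_mulA absgal_mul1
  absgal_mulr1 absgal_mulV absgal_mulrV.

(* The Krull topology: the automorphisms agreeing with s on a finite sequence e
   of elements of Ks form the coset s Gal(Ks/K(e)). *)
Definition krull_open (A : set absgal) : Prop :=
  forall s, A s -> exists e : seq Ks,
    forall t, {in e, (t : Ks -> Ks) =1 s} -> A t.

Lemma krull_openT : krull_open setT.
Proof. by move=> s _; exists [::]. Qed.

Lemma krull_openI : setI_closed krull_open.
Proof.
move=> A B oA oB s [/oA[e eA] /oB[f fB]]; exists (e ++ f) => t h.
by split; [apply: eA | apply: fB] => x xe; apply: h; rewrite mem_cat xe ?orbT.
Qed.

Lemma krull_open_bigU (I : Type) (f : I -> set absgal) :
  (forall i, krull_open (f i)) -> krull_open (\bigcup_i f i)%classic.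
Proof.
by move=> fo s [i _ /fo[e eP]]; exists e => t /eP; exists i.
Qed.

HB.instance Definition _ :=
  isOpenTopological.Build absgal krull_openT krull_openI krull_open_bigU.

Lemma nbhs_krullP s (A : set absgal) :
  nbhs s A <-> exists e : seq Ks, forall t, {in e, (t : Ks -> Ks) =1 s} -> A t.
Proof.
split=> [[B [oB Bs sBA]]|[e eA]].
  by have [e eB] := oB s Bs; exists e => t /eB /sBA.
exists [set t : absgal | {in e, (t : Ks -> Ks) =1 s}]%classic; split=> //.
by move=> t /= ht; exists e => u hu x xe; rewrite hu // ht.
Qed.

Lemma absgal_mul_continuous :
  continuous (fun st : absgal * absgal => (st.1 * st.2)%g).
Proof.
move=> [s t] A /= /nbhs_krullP[e eA].
exists ([set s' : absgal | {in map t e, (s' : Ks -> Ks) =1 s}],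
        [set t' : absgal | {in e, (t' : Ks -> Ks) =1 t}])%classic => /=.
  by split; apply/nbhs_krullP; [exists (map t e) | exists e].
move=> [s' t'] /= [hs ht]; apply: eA => x xe.
by rewrite /mul /= ht // hs // map_f.
Qed.

Lemma absgal_inv_continuous : continuous (fun s : absgal => s^-1%g).
Proof.
move=> s A /= /nbhs_krullP[e eA]; apply/nbhs_krullP.
exists (map (absgal_inv s) e) => t ht; apply: eA => x xe.
rewrite -[in LHS](absgal_invVK s x) -ht ?map_f //.
exact: absgal_invK.
Qed.

HB.instance Definition _ :=
  isTopGroup.Build absgal absgal_mul_continuous absgal_inv_continuous.

End AbsoluteGaloisGroup.

Section KummerCharacter.
Variables (p : nat) (K Ks : fieldType) (iota : {rmorphism K -> Ks}).

Definition kummer_spec (zeta a : K) : set (H1 p (absgal iota)) :=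
  fun chi => forall r : Ks, r ^+ p = iota a ->
    forall s : absgal iota, s r = iota zeta ^+ (chi s) * r.

(* The default 0 is irrelevant: by kummer_charP and kummer_spec_unique below,
   kummer_spec zeta a is a singleton for a != 0. *)
Definition kummer_char (zeta a : K) : H1 p (absgal iota) :=
  xget 0 (kummer_spec zeta a).

Hypothesis sepK : separable_closure iota.
Variables (zeta : K) (zetaP : p.-primitive_root zeta).

Lemma kummer_root_exists (a : K) : a != 0 -> exists r : Ks, r ^+ p = iota a.
Proof.
move=> a0; have p0 := prim_order_gt0 zetaP.
have ia0 : iota a != 0 by rewrite fmorph_eq0.
have pn0 : p%:R != 0 :> Ks.
  by rewrite -(rmorph_nat iota) fmorph_eq0 (prim_root_natf_neq0 zetaP).
have [||r] := sepclosure_closed sepK (q := 'X^p - (iota a)%:P).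
- rewrite separable_poly.unlock; apply/Bezout_coprimepP.
  exists (p%:R, - 'X) => /=.
  suff -> : p%:R * ('X^p - (iota a)%:P) + - 'X * ('X^p - (iota a)%:P)^`() =
      (- (p%:R * iota a))%:P.
    by rewrite polyC_eqp1 oppr_eq0 mulf_neq0.
  rewrite derivB derivC subr0 derivXn mulNr mulrnAr -exprS prednK //.
  by rewrite polyCN polyCM polyC_natr -mulr_natl; ring.
- by rewrite size_XnsubC.
- by rewrite rootE !hornerE subr_eq0 => /eqP rp; exists r.
Qed.

Hypothesis p_prime : prime p.

Let iz : p.-primitive_root (iota zeta).
Proof. by rewrite fmorph_primitive_root. Qed.

Let izX (x : 'F_p) n : n = x %[mod p] -> iota zeta ^+ n = iota zeta ^+ x.
Proof. by move=> e; apply/eqP; rewrite (eq_prim_root_expr iz) e. Qed.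

Lemma kummer_spec_exists (a : K) : a != 0 -> exists chi, kummer_spec zeta a chi.
Proof.
move=> a0; have [r rp] := kummer_root_exists a0.
have p0 := prim_order_gt0 zetaP.
have r0 : r != 0.
  by apply: contra_eq_neq rp => ->; rewrite expr0n gtn_eqF // eq_sym fmorph_eq0.
have ex (s : absgal iota) : exists x : 'F_p, s r = iota zeta ^+ x * r.
  have [_ [s1 sM] _ sK] := absgalP s.
  have sX n : s (r ^+ n) = s r ^+ n.
    by elim: n => [|n IH]; rewrite ?expr0 // !exprS sM IH.
  have /(prim_rootP iz)[i ri] : (s r / r) ^+ p = 1.
    by rewrite expr_div_n -sX rp sK divff // fmorph_eq0.
  exists (i%:R); rewrite -(@izX _ i) ?val_Fp_nat ?modn_mod //.
  by rewrite -ri divfK.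
pose c s := projT1 (cid (ex s)).
have cP (s : absgal iota) : s r = iota zeta ^+ c s * r := projT2 (cid (ex s)).
have c_inj (s : absgal iota) (x : 'F_p) : s r = iota zeta ^+ x * r -> c s = x.
  rewrite cP => /(mulIf r0)/eqP; rewrite (eq_prim_root_expr iz).
  rewrite !modn_small ?(leq_trans (ltn_ord _)) ?Fp_cast //.
  by move/eqP/val_inj.
have sZ (s : absgal iota) n : s (iota zeta ^+ n) = iota zeta ^+ n.
  by have [_ _ _ sK] := absgalP s; rewrite -rmorphXn sK.
have sM (s : absgal iota) x y : s (x * y) = s x * s y.
  by have [_ [_ sM] _ _] := absgalP s.
have cH : c \in @cocycle1 p (absgal iota).
  apply/asboolP; split=> [|s t].
    apply/continuous_discrete => s; apply/nbhs_krullP.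
    exists [:: r] => t ht /=; apply: c_inj.
    by rewrite ht ?inE // cP.
  apply: c_inj; rewrite [LHS]/= cP sM sZ cP mulrA -exprD addnC.
  congr (_ * _); apply: izX.
  have -> : c s + c t = (c s + c t)%N%:R by rewrite natrD !natr_Zp.
  by rewrite val_Fp_nat // modn_mod.
exists (Cocycle1 cH) => r' r'p s /=.
have /(prim_rootP iz)[i ri] : (r' / r) ^+ p = 1.
  by rewrite expr_div_n r'p rp divff // fmorph_eq0.
have -> : r' = iota zeta ^+ i * r by rewrite -ri divfK.
by rewrite sM sZ cP mulrCA.
Qed.

Lemma kummer_charP (a : K) : a != 0 -> kummer_spec zeta a (kummer_char zeta a).
Proof. by move=> /kummer_spec_exists; apply: xgetPex. Qed.

Lemma kummer_spec_unique (a : K) chi psi : a != 0 ->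
  kummer_spec zeta a chi -> kummer_spec zeta a psi -> chi = psi.
Proof.
move=> a0 h k; have [r rp] := kummer_root_exists a0.
have p0 := prim_order_gt0 zetaP.
have r0 : r != 0.
  by apply: contra_eq_neq rp => ->; rewrite expr0n gtn_eqF // eq_sym fmorph_eq0.
apply/val_inj/funext => s; move: (h r rp s); rewrite (k r rp s).
move=> /(mulIf r0)/eqP; rewrite (eq_prim_root_expr iz).
rewrite !modn_small ?(leq_trans (ltn_ord _)) ?Fp_cast //.
by move=> /eqP/val_inj.
Qed.

End KummerCharacter.

Definition unitriangular (n p : nat) : {set {'GL_n(p)}} :=
  [set g | [forall i : 'I_n.-1.+1, forall j : 'I_n.-1.+1,
              (j <= i)%N ==> (GLval g i j == (i == j)%:R)]].

Lemma unitriangularP (n p : nat) (g : {'GL_n(p)}) :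
  reflect (forall i j : 'I_n.-1.+1, (j <= i)%N -> GLval g i j = (i == j)%:R)
          (g \in unitriangular n p).
Proof.
rewrite inE; apply: (iffP 'forall_forallP) => h i j.
  by have /implyP/[apply]/eqP := h i j.
by apply/implyP => /h ->.
Qed.

Lemma unitriangular_group_set (n p : nat) : group_set (unitriangular n p).
Proof.
apply/group_setP; split=> [|g h /unitriangularP gU /unitriangularP hU].
  by apply/unitriangularP => i j _; rewrite GL_1E mxE.
apply/unitriangularP => i j ji; rewrite GL_MxE mxE (bigD1 i) //= gU // eqxx.
rewrite mul1r hU // big1 ?addr0 // => k ki.
have [ki'|ik] := leqP k i; first by rewrite gU // eq_sym (negPf ki) mul0r.
rewrite hU ?(leq_trans ji) ?(ltnW ik) //.
suff /negPf-> : k != j by rewrite mulr0.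
by apply: contraTneq ik => ->; rewrite -leqNgt.
Qed.

Canonical unitriangular_group (n p : nat) := Group (unitriangular_group_set n p).

(* Main.v *)
From HB Require Import structures.
Require Import Defs.
From mathcomp Require Import all_boot all_order all_algebra all_fingroup.
From mathcomp Require Import all_field generic_quotient ring_quotient fraction.
From mathcomp Require Import boolp classical_sets reals topology complex.
From mathcomp Require Import ring zify.

Set Implicit Arguments.
Unset Strict Implicit.
Unset Printing Implicit Defensive.

Import Order.TTheory GRing.Theory Num.Theory.

Local Open Scope ring_scope.

(** An embedding into a unitriangular extension is a continuous surjective
    homomorphism from the absolute Galois group [G] onto the group of 4 by 4
    unitriangular matrices over [F_p], with the three Kummer characters on the
    superdiagonal. The remaining entries are cochains bounding the two cup
    products and a third cochain in the corner, which exists when the triple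
    Massey product vanishes. Everything follows from Hilbert's theorem 90, by a
    construction in the style of Minac and Tan.

    Choose [x] and [y] in [G] with characters (1, 0, 0) and (0, 0, 1). The
    vanishing of the cup products gives [alpha] in [K(a^(1/p))] and [gamma] in
    [K(c^(1/p))] of norm [b] ([norm_of_cup]). On [E = K(a^(1/p), c^(1/p))] the
    element [gamma / alpha] has norm 1 under [x * y], so it is of the form
    [(x * y) e / e] ([norm_quotient]). Let [A] be the norm of [e] under [y] and
    [C] the inverse of its norm under [x]. Then [x A / A = b / alpha ^+ p] and
    [y C / C = b / gamma ^+ p], so [A] and [C] give the entries next to the
    corner; moreover [C * (x e) ^+ p] and [A / e ^+ p] have norm 1 under [x] and
    [y] respectively, and they are compatible: they are the values at [x] and [y]
    of a cocycle of the Galois group of [E]. Hilbert 90 produces [d] with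
    [x d / d = C * (x e) ^+ p] and [y d / d = A / e ^+ p], and the Kummer cochain
    of a [p]-th root of [d] is the corner entry ([massey_cochains]).

    Linear independence of the classes makes the three characters jointly
    surjective ([kummer_onto3]), because the fixed field of [G] is [K]
    ([fixed_by_absgal], where automorphisms are extended by Zorn's lemma), and
    commutators then fill the unitriangular group ([u4_entries_onto]). The kernel
    of the homomorphism is the stabilizer of the six [p]-th roots involved, and
    [K] is infinite, so its fixed field has a primitive element whose minimal
    polynomial defines the extension [L] ([realization]). *)

(** * Automorphisms of a separable closure *)

Section PartialEmbeddings.
Variables (K Ks : fieldType) (iota : {rmorphism K -> Ks}).
Hypothesis sepK : separable_closure iota.

Local Open Scope classical_set_scope.

(** The graph of a ring morphism over [K] from a subring of [Ks] to [Ks], seen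
    as a subring of [Ks * Ks]: polynomials over the source and their images are
    then handled together, as polynomials over the product ring. *)
Record partial_emb (D : set (Ks * Ks)) : Prop := {
  pembK : forall k, D (iota k, iota k);
  pembB : forall u v, D u -> D v -> D (u - v);
  pembM : forall u v, D u -> D v -> D (u * v);
  pemb_fun : forall u, D u -> u.1 = 0 -> u.2 = 0 }.

Definition polys_in (D : set (Ks * Ks)) : set {poly Ks * Ks} :=
  [set P | forall i, D P`_i].

Lemma poly_finite_roots (F : fieldType) (q : {poly F}) :
  q != 0 -> exists rs : seq F, forall x, root q x -> x \in rs.
Proof.
move: {2}(size q) (leqnn (size q)) => n; elim: n => [|n IHn] in q *.
  by rewrite leqn0 size_poly_eq0 => ->.
move=> szq q0; have [[x rx]|nr] := pselect (exists x, root q x); last first.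
  by exists [::] => x rx; case: nr; exists x.
have /factor_theorem[r qE] := rx.
have r0 : r != 0 by apply: contraNneq q0 => r0; rewrite qE r0 mul0r.
have [|//|rs rsP] := IHn r.
  by move: szq; rewrite qE size_Mmonic ?monicXsubC // size_XsubC addn2.
exists (x :: rs) => y; rewrite qE rootM root_XsubC inE => /orP[/rsP->|->] //.
exact: orbT.
Qed.

Lemma size_map_monic (R S1 S2 : nzRingType) (f : {rmorphism R -> S1})
    (g : {rmorphism R -> S2}) (P : {poly R}) :
  P \is monic -> size (map_poly f P) = size (map_poly g P).
Proof.
move=> /eqP lP; rewrite !size_map_poly_id0 //; by rewrite lP rmorph1 oner_eq0.
Qed.

Section Closure.
Variable D : set (Ks * Ks).
Hypothesis pD : partial_emb D.

Lemma pemb0 : D 0.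
Proof. by rewrite -(subrr (iota 0, iota 0)); apply: (pembB pD); apply: (pembK pD). Qed.

Lemma pemb1 : D 1.
Proof. by have := pembK pD 1; rewrite rmorph1. Qed.

Lemma pembN u : D u -> D (- u).
Proof. by rewrite -sub0r; apply: (pembB pD); apply: pemb0. Qed.

Lemma pembD u v : D u -> D v -> D (u + v).
Proof. by move=> Du Dv; rewrite -[v]opprK; apply: (pembB pD) => //; apply: pembN. Qed.

Lemma pemb_sum (I : Type) (r : seq I) (P : pred I) (F : I -> Ks * Ks) :
  (forall i, D (F i)) -> D (\sum_(i <- r | P i) F i).
Proof. by move=> h; apply: big_ind => [||i _]; [apply: pemb0|apply: pembD|]. Qed.

Lemma polys_inB P Q : polys_in D P -> polys_in D Q -> polys_in D (P - Q).
Proof. by move=> DP DQ i; rewrite coefB; apply: (pembB pD). Qed.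

Lemma polys_inM P Q : polys_in D P -> polys_in D Q -> polys_in D (P * Q).
Proof.
by move=> DP DQ i; rewrite coefM; apply: pemb_sum => j; apply: (pembM pD).
Qed.

Lemma polys_inC u : D u -> polys_in D u%:P.
Proof. by move=> Du i; rewrite coefC; case: ifP => _ //; apply: pemb0. Qed.

Lemma polys_inXn n : polys_in D 'X^n.
Proof. by move=> i; rewrite coefXn; case: eqP => _; [apply: pemb1|apply: pemb0]. Qed.

Lemma pemb_horner P u : polys_in D P -> D u -> D P.[u].
Proof.
move=> DP Du; rewrite horner_coef; apply: pemb_sum => i; apply: (pembM pD) => //.
by elim: (nat_of_ord i) => [|n IHn]; rewrite ?expr0 ?exprS;
  [apply: pemb1 | apply: (pembM pD)].
Qed.

Let diag k : Ks * Ks := (iota k, iota k).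
Let diagB : zmod_morphism diag.
Proof. by move=> k l; rewrite /diag rmorphB. Qed.
Let diagM : monoid_morphism diag.
Proof. by split=> [|k l]; rewrite /diag ?rmorph1 ?rmorphM. Qed.
HB.instance Definition _ := GRing.isZmodMorphism.Build K (Ks * Ks)%type diag diagB.
HB.instance Definition _ := GRing.isMonoidMorphism.Build K (Ks * Ks)%type diag diagM.

Lemma diag_in (q : {poly K}) : polys_in D (map_poly diag q).
Proof. by move=> i; rewrite coef_map; apply: (pembK pD). Qed.

Lemma fst_diag (q : {poly K}) : map_poly fst (map_poly diag q) = map_poly iota q.
Proof. by rewrite -map_poly_comp. Qed.

Lemma snd_diag (q : {poly K}) : map_poly snd (map_poly diag q) = map_poly iota q.
Proof. by rewrite -map_poly_comp. Qed.

(** Every element of [Ks] is algebraic over [K], so the source of a partial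
    embedding is automatically a field: the inverse of [u] is a polynomial in
    [u] over [K]. *)
Lemma pembV u : D u -> u.1 != 0 -> exists2 v, D v & v * u = 1.
Proof.
move=> Du u0; have [q sq rq] := sepclosure_algebraic sepK u.1.
have q0 : q != 0 by apply: separable_poly_neq0.
wlog rq0 : q rq q0 {sq} / ~~ root q 0.
  move=> h; have [n [r r0 qE]] := multiplicity_XsubC q 0.
  rewrite q0 /= in r0; apply: (h r) => //; last first.
    by apply: contraNneq r0 => ->; rewrite root0.
  move: rq; rewrite qE rmorphM /= rootM rmorphXn /= rmorphB /= map_polyX map_polyC /=.
  rewrite rmorph0 subr0; case/orP=> // /rootP.
  by rewrite hornerXn => /eqP; rewrite expf_eq0 (negPf u0) andbF.
pose c := q.[0]; have c0 : c != 0 by [].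
have /factor_theorem[r qE] : root (q - c%:P) 0 by rewrite rootE !hornerE subrr.
rewrite subr0 in qE.
pose v := diag (- c^-1) * (map_poly diag r).[u].
have Dv : D v.
  by apply: (pembM pD); [apply: (pembK pD)|apply: pemb_horner => //; apply: diag_in].
exists v => //; suff v1 : (v * u).1 = 1.
  have v2 : (v * u).2 = 1.
    apply/subr0_eq/(pemb_fun pD (pembB pD (pembM pD Dv Du) pemb1))/eqP.
    by rewrite subr_eq0; apply/eqP.
  by move: v1 v2; case: (v * u) => ? ? /= -> ->.
have -> : (v * u).1 = iota (- c^-1) * (fst (map_poly diag r).[u] * u.1) by rewrite mulrA.
rewrite -horner_map fst_diag.
have <- : (map_poly iota (q - c%:P)).[u.1] = (map_poly iota r).[u.1] * u.1.
  by rewrite qE rmorphM /= map_polyX hornerMX.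
rewrite rmorphB /= map_polyC /= hornerD hornerN hornerC (rootP rq) sub0r.
by rewrite rmorphN mulrNN -rmorphM mulVf // rmorph1.
Qed.

(** A minimal polynomial of [x] over the source: dividing by a monic [P0] of
    least degree in the product ring divides both projections at once. Its second
    projection divides the image of a separable polynomial over [K] killing [x],
    hence is separable. *)
Lemma pemb_minpoly x : exists P0 : {poly Ks * Ks},
  [/\ polys_in D P0, P0 \is monic, root (map_poly fst P0) x,
      separable_poly (map_poly snd P0)
    & forall P, polys_in D P -> root (map_poly fst P) x ->
      exists V, P = P0 * V].
Proof.
pose kills n := exists P : {poly Ks * Ks},
  [/\ polys_in D P, P \is monic, root (map_poly fst P) x & size P = n].
have normalize P : polys_in D P -> P != 0 -> root (map_poly fst P) x ->
    exists2 u, D u & u * lead_coef P = 1 /\ kills (size P).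
  move=> DP P0 rP; have [||u Du uP] := @pembV (lead_coef P); first exact: DP.
    apply: contra_neq P0 => l1; apply/eqP; rewrite -lead_coef_eq0.
    by rewrite [lead_coef P]surjective_pairing l1 (pemb_fun pD (DP _) l1).
  exists u => //; split=> //; exists (u%:P * P).
  have szuP : size (u%:P * P) = size P.
    rewrite mul_polyC; apply/eqP; rewrite eqn_leq size_scale_leq /=.
    have {1}-> : P = lead_coef P *: (u *: P) by rewrite scalerA mulrC uP scale1r.
    exact: size_scale_leq.
  split=> //; first by apply: polys_inM => //; apply: polys_inC.
    by rewrite monicE lead_coefE szuP coefCM -lead_coefE uP.
  by rewrite rmorphM rootM rP orbT.
have [q sq rq] := sepclosure_algebraic sepK x.
have q0 := separable_poly_neq0 sq.
have [N [[P0 [DP0 mP0 rP0 <-]] minP]] :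
    exists N, kills N /\ forall m, kills m -> (N <= m)%N.
  have ex : exists n, `[< kills n >].
    have [] := normalize (map_poly diag q); first exact: diag_in.
    - apply: contra_neq q0 => /(congr1 (map_poly fst)).
      by rewrite fst_diag rmorph0 => /eqP; rewrite map_poly_eq0 => /eqP.
    - by rewrite fst_diag.
    - by move=> u _ [_ k]; exists (size (map_poly diag q)); apply/asboolP.
  case: (ex_minnP ex) => n /asboolP kn mn; exists n; split=> // m km.
  by apply: mn; apply/asboolP.
have divP P : polys_in D P -> root (map_poly fst P) x -> exists V, P = P0 * V.
  move: {2}(size P) (leqnn (size P)) => n; elim: n => [|n IHn] in P *.
    rewrite leqn0 size_poly_eq0 => /eqP-> _ _; exists 0; by rewrite mulr0.
  move=> szP DP rP; have [->|Pn0] := eqVneq P 0; first by exists 0; rewrite mulr0.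
  have [_ _ [_ /minP le0]] := normalize P DP Pn0 rP.
  pose M := lead_coef P *: 'X^(size P - size P0).
  have DM : polys_in D M.
    rewrite /M -mul_polyC; apply: polys_inM; last exact: polys_inXn.
    by apply: polys_inC; apply: DP.
  have [|||V VE] := IHn (P - P0 * M).
  - have sz1 : (size (P - P0 * M)%R <= size P)%N.
      rewrite (leq_trans (size_polyD _ _)) // geq_max leqnn size_polyN.
      rewrite (leq_trans (size_polyMleq _ _)) //.
      have szM : (size M <= (size P - size P0).+1)%N.
        by rewrite (leq_trans (size_scale_leq _ _)) ?size_polyXn.
      apply: leq_trans (_ : (size P0 + (size P - size P0).+1).-1 <= _)%N.
        by rewrite -!subn1 leq_sub2r // leq_add2l.
      by rewrite addnS /= subnKC.
    rewrite -ltnS (leq_trans _ szP) // ltn_neqAle sz1 andbT.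
    apply: contraTneq (Pn0) => szE; rewrite negbK -lead_coef_eq0.
    suff : lead_coef (P - P0 * M) == 0.
      rewrite lead_coef_eq0 -size_poly_eq0 szE size_poly_eq0 => /eqP->.
      by rewrite lead_coef0.
    rewrite lead_coefE szE coefB.
    have -> : (P0 * M)`_(size P).-1 = lead_coef P.
      rewrite /M -scalerAr coefZ coefMXn.
      have sz0 : (0 < size P0)%N by rewrite size_poly_gt0 monic_neq0.
      have aux (m n' : nat) : (0 < m -> m <= n' -> (n'.-1 < n' - m) = false /\
          n'.-1 - (n' - m) = m.-1)%N by move=> *; split; lia.
      have [-> ->] := aux _ _ sz0 le0.
      by rewrite -lead_coefE (eqP mP0) mulr1.
    by rewrite -lead_coefE subrr.
  - by apply: polys_inB => //; apply: polys_inM.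
  - by rewrite rmorphB rmorphM rootE !hornerE (rootP rP) (rootP rP0) mul0r subr0.
  by exists (V + M); rewrite mulrDr -VE subrK.
exists P0; split=> //.
have [|//|V VE] := divP (map_poly diag q); first exact: diag_in.
  by rewrite fst_diag.
apply: dvdp_separable (_ : separable_poly (map_poly iota q)).
  by rewrite -snd_diag VE rmorphM dvdp_mulr.
by rewrite separable_map.
Qed.

(** Mapping [x] to a root [y] of the image of its minimal polynomial extends the
    embedding: the new graph is the set of values at [(x, y)]. *)
Lemma pemb_adjoin x y P0 :
  (forall P, polys_in D P -> root (map_poly fst P) x -> exists V, P = P0 * V) ->
  root (map_poly snd P0) y ->
  partial_emb [set u | exists2 P, polys_in D P & u = P.[(x, y)]].
Proof.
move=> minP ry; split=> [k|_ _ [P DP ->] [Q DQ ->]|_ _ [P DP ->] [Q DQ ->]|_ [P DP ->]].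
- by exists (diag k)%:P; [apply: polys_inC; apply: (pembK pD)|rewrite hornerC].
- by exists (P - Q); [apply: polys_inB|rewrite !hornerE].
- by exists (P * Q); [apply: polys_inM|rewrite hornerM].
rewrite -!horner_map /= => /rootP /(minP _ DP)[V ->].
by rewrite rmorphM hornerM (rootP ry) mul0r.
Qed.

End Closure.

(** By Zorn's lemma there is a maximal extension, which is total by
    [pemb_adjoin]; it is onto because it permutes the finite set of roots of each
    polynomial over [K]. *)
Lemma pemb_extend (D0 : set (Ks * Ks)) : partial_emb D0 ->
  exists s : absgal iota, forall u, D0 u -> s u.1 = u.2.
Proof.
move=> p0.
(* The union with [D0] keeps the empty chain admissible. *)
have [F FP Ftot|A [pA maxA]] := @Zorn_bigcup _ (fun A => partial_emb (A `|` D0)).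
  have [->|/set0P[A0 FA0]] := eqVneq F set0; first by rewrite bigcup_set0 set0U.
  have up (u v : Ks * Ks) : ((\bigcup_(X in F) X) `|` D0) u ->
      ((\bigcup_(X in F) X) `|` D0) v ->
      exists2 A, F A & (A `|` D0) u /\ (A `|` D0) v.
    case=> [[A FA Au]|Du] [[B FB Bv]|Dv].
    - have [AB|BA] := Ftot A B FA FB; [exists B|exists A] => //.
        by split; left => //; apply: AB.
      by split; left => //; apply: BA.
    - by exists A => //; split; [left|right].
    - by exists B => //; split; [right|left].
    - by exists A0 => //; split; right.
  split=> [k|u v hu hv|u v hu hv|u hu].
  - by right; apply: (pembK p0).
  - have [A FA [Au Av]] := up u v hu hv.
    by have [h|h] := pembB (FP A FA) Au Av; [left; exists A|right].
  - have [A FA [Au Av]] := up u v hu hv.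
    by have [h|h] := pembM (FP A FA) Au Av; [left; exists A|right].
  - by have [A FA [Au _]] := up u u hu hu; apply: (pemb_fun (FP A FA)).
set D := A `|` D0 in pA.
have maxD D' : D `<=` D' -> partial_emb D' -> D' `<=` D.
  move=> DD' pD' u D'u; left; apply: contrapT => nAu.
  apply: (maxA D').
    by split=> [v Av|D'A]; [apply: DD'; left | apply/nAu/D'A].
  suff -> : D' `|` D0 = D' by [].
  by apply/setUidPl => v D0v; apply: DD'; right.
have tot x : exists y, D (x, y).
  have [P0 [DP0 mP0 rP0 sP0 minP0]] := pemb_minpoly pA x.
  have [//||y ry] := sepclosure_closed sepK (q := map_poly snd P0).
    by rewrite -(size_map_monic fst snd) // (root_size_gt1 _ rP0) // monic_neq0 // monic_map.
  exists y; have pD' := pemb_adjoin pA minP0 ry.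
  apply: (maxD _ _ pD').
    by move=> u Du; exists u%:P; [apply: polys_inC|rewrite hornerC].
  by exists 'X; [rewrite -['X]expr1; apply: polys_inXn|rewrite hornerX].
have [f fP] := boolp.choice tot.
have f_fun u : D u -> f u.1 = u.2.
  move=> Du; have := pemb_fun pA (pembB pA (fP u.1) Du).
  by rewrite /= subrr => /(_ erefl) /eqP; rewrite subr_eq0 => /eqP.
have fK k : f (iota k) = iota k by apply: (f_fun (iota k, iota k)); apply: pembK.
have fB : zmod_morphism f.
  by move=> u v; apply: (f_fun (u - v, f u - f v)); apply: (pembB pA (fP u) (fP v)).
have fM : monoid_morphism f.
  split=> [|u v]; first by rewrite -(rmorph1 iota) fK.
  by apply: (f_fun (u * v, f u * f v)); apply: (pembM pA (fP u) (fP v)).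
pose Lf := GRing.isZmodMorphism.Build Ks Ks f fB.
pose Mf := GRing.isMonoidMorphism.Build Ks Ks f fM.
pose g : {rmorphism Ks -> Ks} := HB.pack f Lf Mf.
have g_inj : injective f by apply: (fmorph_inj g).
have g_surj z : exists w, f w = z.
  have [q sq rq] := sepclosure_algebraic sepK z.
  have [|rs rsP] := @poly_finite_roots Ks (map_poly iota q).
    by rewrite map_poly_eq0 separable_poly_neq0.
  pose rt := undup [seq y <- rs | root (map_poly iota q) y].
  have rtE y : (y \in rt) = root (map_poly iota q) y.
    by rewrite mem_undup mem_filter andb_idr //; apply: rsP.
  have [_ h] : (size (map f rt) = size rt) * (map f rt =i rt).
    apply: uniq_min_size; rewrite ?map_inj_uniq ?undup_uniq ?size_map //.
    move=> _ /mapP[y yr ->]; rewrite rtE in yr; rewrite rtE.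
    have -> : map_poly iota q = map_poly g (map_poly iota q).
      by rewrite -map_poly_comp; apply: eq_map_poly => k /=; rewrite fK.
    by rewrite (fmorph_root g).
  have /mapP[w _ ->] : z \in map f rt by rewrite h rtE.
  by exists w.
have [h hP] := boolp.choice g_surj.
have fA : f \in is_Kaut iota.
  by apply/asboolP; split=> //; exists h => z; [apply: g_inj; rewrite hP|].
by exists (AbsGal fA) => u D0u; apply: f_fun; right.
Qed.

(** An element outside [K] has a second root [y] of its minimal polynomial, as
    that polynomial is separable of degree at least 2, and the [K]-embedding
    sending it to [y] extends to the whole closure. *)
Lemma fixed_by_absgal x : (forall s : absgal iota, s x = x) -> exists k, x = iota k.
Proof.
move=> fixx; pose D : set (Ks * Ks) := [set u | exists k, u = (iota k, iota k)].
have pD : partial_emb D.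
  split=> [k|_ _ [k ->] [l ->]|_ _ [k ->] [l ->]|_ [k ->] //]; first by exists k.
    by exists (k - l); rewrite rmorphB.
  by exists (k * l); rewrite rmorphM.
have [P0 [DP0 mP0 rP0 sP0 minP0]] := pemb_minpoly pD x.
have eqP0 : map_poly fst P0 = map_poly snd P0.
  by apply/polyP => i; rewrite !coef_map; have [k ->] := DP0 i.
have /factor_theorem[r rE] := rP0.
have r_m : r \is monic.
  by rewrite -(monicMr _ (monicXsubC x)) -rE monic_map.
have [sr|sr] := leqP (size r) 1.
  have r1 : r = 1.
    by move: r_m; rewrite (size1_polyC sr) monicE lead_coefC => /eqP->.
  have [k kE] := DP0 0; exists (- k).
  have := congr1 (fun P : {poly Ks} => P`_0) rE.
  by rewrite r1 mul1r coefB coefX coefC coef_map kE /= sub0r rmorphN => ->; rewrite opprK.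
have sep : separable_poly (r * ('X - x%:P)) by rewrite -rE eqP0.
rewrite separable_root in sep; case/andP: sep => sr' nrx.
have [y ry] := sepclosure_closed sepK sr' sr.
have [|s sP] := pemb_extend (pemb_adjoin pD (y := y) minP0 _).
  by rewrite -eqP0 rE rootM ry.
have : s x = y.
  apply: (sP (x, y)); exists 'X; last by rewrite hornerX.
  by rewrite -['X]expr1; apply: polys_inXn.
by rewrite fixx => xy; rewrite xy ry in nrx.
Qed.

End PartialEmbeddings.

(** * The absolute Galois group acting on the separable closure *)

Section GaloisAction.
Variables (K Ks : fieldType) (iota : {rmorphism K -> Ks}).
Local Notation G := (absgal iota).
Implicit Types (s t : G) (H : set G).

Lemma absgal_zmod_morphism s : zmod_morphism s.
Proof. by case: (absgalP s). Qed.
Lemma absgal_monoid_morphism s : monoid_morphism s.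
Proof. by case: (absgalP s). Qed.
HB.instance Definition _ s :=
  GRing.isZmodMorphism.Build Ks Ks (absgal_fun s) (absgal_zmod_morphism s).
HB.instance Definition _ s :=
  GRing.isMonoidMorphism.Build Ks Ks (absgal_fun s) (absgal_monoid_morphism s).

Lemma absgalM s t x : (s * t)%g x = s (t x).
Proof. by []. Qed.

Lemma absgal1 x : (1 : G)%g x = x.
Proof. by []. Qed.

Lemma absgalVK s x : (s^-1)%g (s x) = x.
Proof. by rewrite -absgalM mulVg. Qed.

Lemma absgalKV s x : s ((s^-1)%g x) = x.
Proof. by rewrite -absgalM mulgV. Qed.

Lemma absgal_iota s k : s (iota k) = iota k.
Proof. by case: (absgalP s). Qed.

Lemma map_poly_absgal s (q : {poly K}) :
  map_poly s (map_poly iota q) = map_poly iota q.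
Proof. by rewrite -map_poly_comp; apply: eq_map_poly => k /=; rewrite absgal_iota. Qed.

(** Dedekind's independence of characters. Restricting to a submonoid [M] lets
    the automorphisms be distinguished by their action on finitely many elements
    only. *)
Lemma absgal_independent (M : set Ks) (R : seq G) (k : G -> Ks) :
  M 1 -> (forall x y, M x -> M y -> M (x * y)) -> uniq R ->
  {in R &, forall r r' : G, r != r' -> exists2 z, M z & r z != r' z} ->
  (forall z, M z -> \sum_(r <- R) k r * r z = 0) -> {in R, forall r, k r = 0}.
Proof.
move=> M1 MM; elim: R k => [|r0 R IHR] // k /= /andP[r0R uR] sepR sum0.
have kR : {in R, forall r, k r = 0}.
  move=> r rR; have r0r : r0 != r by apply: contraNneq r0R => ->.
  have [||z0 Mz0 z0P] := sepR r0 r _ _ r0r; rewrite ?inE ?eqxx ?rR ?orbT //.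
  have /IHR : uniq R by [].
  move=> /(_ (fun r => k r * (r z0 - r0 z0))) /(_ _ _ r rR) h.
  have /eqP : k r * (r z0 - r0 z0) = 0.
    apply: h => [u v uR' vR'|z Mz].
      by apply: sepR; rewrite inE ?uR' ?vR' orbT.
    have := sum0 (z0 * z) (MM _ _ Mz0 Mz); rewrite big_cons => /(canRL (addKr _)) e1.
    have := sum0 z Mz; rewrite big_cons => /(canRL (addKr _)) e0.
    transitivity (\sum_(u <- R) k u * u (z0 * z) - r0 z0 * \sum_(u <- R) k u * u z).
      by rewrite mulr_sumr -sumrB; apply: eq_bigr => u _; rewrite rmorphM /=; ring.
    by rewrite e1 e0 rmorphM /=; ring.
  by rewrite mulf_eq0 subr_eq0 [r z0 == _]eq_sym (negPf z0P) orbF => /eqP.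
move=> r; rewrite inE => /orP[/eqP->|/kR//].
have := sum0 1 M1; rewrite big_cons rmorph1 mulr1 big_seq big1 ?addr0 // => u /kR->.
by rewrite mul0r.
Qed.

Hypothesis sepK : separable_closure iota.

Lemma finite_conjugates x : exists W : seq Ks, forall s : G, s x \in W.
Proof.
have [q sq rq] := sepclosure_algebraic sepK x.
have [|W WP] := @poly_finite_roots Ks (map_poly iota q).
  by rewrite map_poly_eq0 separable_poly_neq0.
by exists W => s; apply: WP; rewrite -(map_poly_absgal s) fmorph_root.
Qed.

Lemma finite_restrictions (e : seq Ks) :
  exists W : seq (seq Ks), forall s : G, map s e \in W.
Proof.
elim: e => [|x e [W WP]]; first by exists [:: [::]] => s; rewrite inE.
have [V VP] := finite_conjugates x.
exists [seq y :: w | y <- V, w <- W] => s.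
by apply/allpairsP; exists (s x, map s e); split; rewrite ?VP ?WP.
Qed.

(** There are finitely many restrictions to [e]; they stand in for the elements
    of a finite Galois group when averaging. *)
Lemma restriction_reps H (e : seq Ks) : exists R : seq G,
  [/\ {in R, forall r, H r}, uniq [seq map r e | r : G <- R]
    & forall s, H s -> map s e \in [seq map r e | r : G <- R]].
Proof.
have [W WP] := finite_restrictions e.
suff [R [RH uR RP]] : exists R : seq G,
  [/\ {in R, forall r, H r}, uniq [seq map r e | r : G <- R]
    & forall s, H s -> map s e \in W -> map s e \in [seq map r e | r : G <- R]].
  by exists R; split=> // s Hs; apply: RP.
elim: W {WP} => [|w W [R [RH uR RP]]]; first by exists [::]; split.
have [[s [Hs sw sR]]|no] :=
    pselect (exists s, [/\ H s, map s e = w & map s e \notin [seq map r e | r : G <- R]]).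
  exists (s :: R); split=> [r|/=|t Ht]; first by rewrite inE => /orP[/eqP->|/RH].
    by rewrite sR.
  by rewrite !inE -sw => /orP[->//|/(RP t Ht)->]; rewrite orbT.
exists R; split=> // s Hs; rewrite inE => /orP[/eqP sw|]; last exact: RP.
by apply: contrapT => nR; apply: no; exists s; split=> //; apply/negP.
Qed.

(** Hilbert's theorem 90 for a subgroup [H]: the average of [c r * r z] over
    representatives [r] of the finite set of restrictions to [e] inverts to a
    solution, and is nonzero for a suitable [z] by independence of characters. *)
Lemma hilbert90 H (c : G -> Ks) (e : seq Ks) :
  (forall s t, H s -> H t -> H (s * t)%g) ->
  (forall s, H s -> c s != 0) ->
  (forall s t, H s -> H t -> c (s * t)%g = c s * s (c t)) ->
  (forall s t, H s -> H t -> {in e, (s : Ks -> Ks) =1 t} -> c s = c t) ->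
  exists2 m, m != 0 & forall s, H s -> s m = c s * m.
Proof.
move=> HM c0 cM ce.
have [[s0 Hs0]|noH] := pselect (exists s, H s); last first.
  by exists 1; rewrite ?oner_eq0 // => s Hs; case: noH; exists s.
have [R [RH uR RP]] := restriction_reps H e.
have agree s t : map s e = map t e -> {in e, (s : Ks -> Ks) =1 t}.
  by move=> /eq_in_map.
(* [M] consists of elements on which an automorphism is determined by [e]. *)
pose M : set Ks := [set z | forall s t, {in e, (s : Ks -> Ks) =1 t} -> s z = t z]%classic.
have [z Mz sum_n0] : exists2 z, M z & \sum_(r <- R) c r * r z != 0.
  apply: contrapT => no; have /mapP[r0 r0R _] := RP s0 Hs0.
  have /eqP := c0 r0 (RH r0 r0R); apply.
  apply: (@absgal_independent M R c) r0R => //.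
  - by move=> s t _; rewrite !rmorph1.
  - by move=> x y Mx My s t st; rewrite !rmorphM /= (Mx s t) // (My s t).
  - exact: map_uniq uR.
  - move=> r r' rR r'R rr'; apply: contrapT => no'; case/eqP: rr'.
    have /eqP : map r e = map r' e.
      apply/eq_in_map => x xe; apply: contrapT => xP; apply: no'; exists x; last exact/eqP.
      by move=> s t; apply.
    have [i iR <-] := nthP 1%g rR; have [j jR <-] := nthP 1%g r'R.
    rewrite -!(nth_map _ [::] (fun r : G => map r e)) // nth_uniq ?size_map // => /eqP->.
    by [].
  - by move=> z Mz; apply: contrapT => h; apply: no; exists z => //; apply/eqP.
pose rep w := nth 1%g R (index w [seq map r e | r : G <- R]).
pose F w := c (rep w) * rep w z.
have FE s : H s -> c s * s z = F (map s e).
  move=> Hs; have sR := RP s Hs; rewrite /F.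
  have iR : (index (map s e) [seq map r e | r : G <- R] < size R)%N.
    by rewrite -(size_map (fun r : G => map r e)) index_mem.
  have repR : rep (map s e) \in R by rewrite mem_nth.
  have repE : {in e, (s : Ks -> Ks) =1 rep (map s e)}.
    by apply: agree; rewrite /rep -(nth_map _ [::] (fun r : G => map r e)) // nth_index.
  by rewrite -(ce s) ?(Mz _ _ repE) //; apply: RH.
exists (\sum_(r <- R) c r * r z)^-1; first by rewrite invr_eq0.
move=> s Hs; rewrite fmorphV rmorph_sum /=.
suff -> : \sum_(r <- R) c r * r z = c s * \sum_(r <- R) s (c r * r z).
  by rewrite invfM mulrA mulfV ?mul1r ?c0.
rewrite mulr_sumr big_seq [RHS]big_seq.
transitivity (\sum_(w <- [seq map r e | r : G <- R]) F w).
  by rewrite big_map [RHS]big_seq; apply: eq_bigr => r /RH /FE.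
transitivity (\sum_(w <- [seq map (s * r)%g e | r : G <- R]) F w).
  apply/perm_big; rewrite perm_sym.
  have sinj : injective (map s) by apply/inj_map/fmorph_inj.
  have mapsE : [seq map (s * r)%g e | r : G <- R] = map (map s) [seq map r e | r : G <- R].
    by rewrite -map_comp; apply: eq_map => r /=; rewrite -map_comp.
  apply: uniq_perm => //; first by rewrite mapsE map_inj_uniq.
  apply: (uniq_min_size _ _ _).2; rewrite ?size_map //.
    by rewrite mapsE map_inj_uniq.
  by move=> w /mapP[r rR ->]; apply: RP; exact: (HM s r Hs (RH r rR)).
rewrite big_map big_seq; apply: eq_bigr => r /RH Hr.
by rewrite -(FE (s * r)%g) ?cM ?rmorphM ?mulrA //; apply: HM.
Qed.

End GaloisAction.

(** * Realizing a finite quotient as a Galois extension *)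

Section Realization.
Variables (K Ks : fieldType) (iota : {rmorphism K -> Ks}).
Hypothesis sepK : separable_closure iota.
Local Notation G := (absgal iota).
Implicit Types (s t : G).

Lemma fixed_poly (P : {poly Ks}) :
  (forall s : G, map_poly s P = P) -> exists q, P = map_poly iota q.
Proof.
move=> fixP; have fixC i : exists k, P`_i = iota k.
  by apply: (fixed_by_absgal sepK) => s; rewrite -{2}(fixP s) coef_map.
have [f fP] := boolp.choice fixC; exists (\poly_(i < size P) f i).
apply/polyP => i; rewrite coef_map coef_poly; case: ltnP => [_|szP]; first exact: fP.
by rewrite nth_default // raddf0.
Qed.

Variables (gT : finGroupType) (U : {group gT}) (rho : G -> gT) (us : seq Ks).
Hypothesis infK : exists u : nat -> K, injective u.
Hypothesis rhoM : forall s t, rho (s * t)%g = (rho s * rho t)%g.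
Hypothesis rhoU : forall s, rho s \in U.
Hypothesis rho_onto : forall g, g \in U -> exists s, rho s = g.
Hypothesis rho_ker : forall s, rho s = 1%g <-> {in us, (s : Ks -> Ks) =1 id}.

Let lift g : G := xget 1%g [set s | rho s = g]%classic.
Let rho_lift g : g \in U -> rho (lift g) = g.
Proof. by move=> /rho_onto ex; apply: (xgetPex 1%g ex). Qed.

Lemma rho1 : rho 1%g = 1%g.
Proof. by apply: (@mulgI _ (rho 1%g)); rewrite -rhoM !mulg1. Qed.

Lemma rhoV s : rho (s^-1)%g = (rho s)^-1%g.
Proof.
by apply: (@mulgI _ (rho s)); rewrite -rhoM !mulgV rho1.
Qed.

Let fixed x := forall s, rho s = 1%g -> s x = x.

Lemma eq_on_fixed x s t : fixed x -> rho s = rho t -> s x = t x.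
Proof.
move=> fx st; rewrite -[s x](absgalKV t) -(absgalM (t^-1)%g) fx //.
by rewrite rhoM rhoV st mulVg.
Qed.

Lemma lift_fixed x s : fixed x -> lift (rho s) x = s x.
Proof. by move=> fx; apply: eq_on_fixed => //; rewrite rho_lift. Qed.

Lemma lift1 x : fixed x -> lift 1%g x = x.
Proof. by move=> fx; rewrite -rho1 lift_fixed. Qed.

Lemma us_fixed x : x \in us -> fixed x.
Proof. by move=> xu s /rho_ker /(_ x xu). Qed.

(** A primitive element: [theta] is a combination of the [us] with coefficients
    [1, t, t^2, ...], and a [t] for which two conjugates collide is a root of
    one fixed nonzero polynomial. *)
Lemma primitive_element :
  exists2 theta, fixed theta & forall s, s theta = theta -> rho s = 1%g.
Proof.
pose P := Poly us; have fixP i : fixed P`_i.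
  rewrite coef_Poly; have [iu|ui] := ltnP i (size us); first exact/us_fixed/mem_nth.
  by rewrite nth_default // => s _; rewrite rmorph0.
pose D g := map_poly (lift g) P - P.
have [|rs rsP] := @poly_finite_roots Ks (\prod_(g in U | g != 1%g) D g).
  apply/prodf_neq0 => g /andP[gU g1]; rewrite subr_eq0; apply: contraNneq g1 => gP.
  apply/eqP; rewrite -(rho_lift gU); apply/rho_ker => x /(nthP 0)[i iu <-].
  have := congr1 (fun Q : {poly Ks} => Q`_i) gP.
  by rewrite coef_map !coef_Poly.
have [u u_inj] := infK.
have [n nP] : exists n, iota (u n) \notin rs.
  apply: contrapT => no.
  have sub : {subset [seq iota (u n) | n <- seq.iota 0 (size rs).+1] <= rs}.
    by move=> _ /mapP[n _ ->]; apply: contrapT => /negP h; apply: no; exists n.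
  have := uniq_leq_size _ sub; rewrite size_map size_iota ltnn => h.
  have /h // : uniq [seq iota (u n) | n <- seq.iota 0 (size rs).+1].
  by rewrite map_inj_uniq ?iota_uniq // => i j /fmorph_inj /u_inj.
have s_theta s : s P.[iota (u n)] = (map_poly s P).[iota (u n)].
  by rewrite -{2}(absgal_iota s (u n)) horner_map.
exists P.[iota (u n)] => [s s1|s].
  rewrite s_theta; congr _.[_]; apply/polyP => i; rewrite coef_map; exact: fixP.
move=> sx; apply: contrapT => /eqP s1; move: nP; rewrite rsP // rootE horner_prod.
rewrite (bigD1 (rho s)) ?rhoU ?s1 //= /D !hornerE.
suff -> : map_poly (lift (rho s)) P = map_poly s P by rewrite -s_theta sx subrr mul0r.
apply/polyP => i; rewrite !coef_map; exact: lift_fixed.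
Qed.

(** The conjugates of [theta] are indexed by [U], and their product of linear
    factors comes from an irreducible polynomial over [K], since its roots
    are permuted transitively. The field [L] obtained by adjoining one root embeds
    by [j] onto the fixed field of the kernel of [rho]: this makes [L] a splitting
    field, and each automorphism of [L] is induced by some [s], whose image under
    [rho] it determines. *)
Theorem realization : exists L : splittingFieldType K,
  [/\ galois 1 {:L}, 'Gal({:L} / 1) \isog U
    & exists2 j : {rmorphism L -> Ks}, (forall k, j k%:A = iota k)
      & forall x, x \in us -> exists y, j y = x].
Proof.
have [theta fth th1] := primitive_element.
pose th g := lift g theta.
have thE s : s theta = th (rho s) by rewrite /th lift_fixed.
have th_inj : {in U &, injective th}.
  move=> g h gU hU e; rewrite -(rho_lift gU) -(rho_lift hU).
  suff /eqP : rho ((lift h)^-1 * lift g)%g = 1%g.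
    by rewrite rhoM rhoV -eq_mulVg1 => /eqP.
  by apply: th1; rewrite absgalM [lift g theta]e absgalVK.
have sth s g : g \in U -> s (th g) = th (rho s * g)%g.
  by move=> gU; rewrite -{2}(rho_lift gU) -rhoM -thE absgalM.
have reindexU (R : Type) (idx : R) (op : Monoid.com_law idx) s (F : gT -> R) :
    \big[op/idx]_(g in U) F (rho s * g)%g = \big[op/idx]_(g in U) F g.
  rewrite [RHS](reindex_inj (mulgI (rho s))); apply: eq_bigl => g.
  by rewrite groupMl.
pose m := \prod_(g in U) ('X - (th g)%:P).
have [q qE] : exists q, m = map_poly iota q.
  apply: fixed_poly => s; rewrite rmorph_prod /= -[RHS](reindexU _ _ _ s (fun g => 'X - (th g)%:P)).
  by apply: eq_bigr => g gU; rewrite map_polyXsubC /= sth.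
have mE : m = \prod_(x <- [seq th g | g <- enum U]) ('X - x%:P).
  by rewrite big_map big_enum.
have uth : uniq [seq th g | g <- enum U].
  by rewrite map_inj_in_uniq ?enum_uniq // => g h; rewrite !mem_enum; apply: th_inj.
have rth : root (map_poly iota q) theta.
  rewrite -qE mE root_prod_XsubC; apply/mapP; exists (rho 1%g).
    by rewrite mem_enum.
  by rewrite -thE absgal1.
have q0 : q != 0.
  by rewrite -(map_poly_eq0 iota) -qE mE monic_neq0 // monic_prod_XsubC.
have szq : size q = #|U|.+1.
  by rewrite -(size_map_poly iota) -qE mE size_prod_XsubC size_map -cardE.
have irr_q : irreducible_poly q.
  split=> [|d d1 dq]; first by rewrite szq ltnS cardG_gt0.
  have dm : map_poly iota d %| m by rewrite qE dvdp_map.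
  have d0 : map_poly iota d != 0 by rewrite map_poly_eq0; apply: dvdpN0 dq q0.
  have [y yd] : exists y, root (map_poly iota d) y.
    have sm : separable_poly m by rewrite mE separable_prod_XsubC.
    apply: (sepclosure_closed sepK); first exact: dvdp_separable dm sm.
    rewrite size_map_poly; move: d1 d0.
    by rewrite -(size_poly_eq0 (map_poly _ _)) size_map_poly; case: (size d) => [|[|]].
  have : y \in [seq th g | g <- enum U].
    by rewrite -root_prod_XsubC -mE -dvdp_XsubCl (dvdp_trans _ dm) ?dvdp_XsubCl.
  case/mapP=> g; rewrite mem_enum => gU yE.
  have all_th h : h \in U -> root (map_poly iota d) (th h).
    move=> hU; pose s := (lift h * (lift g)^-1)%g.
    have -> : th h = s (th g) by rewrite sth // rhoM rhoV !rho_lift // mulgKV.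
    by rewrite -(map_poly_absgal s) fmorph_root -yE.
  rewrite -(eqp_map iota) /eqp -qE dm /= mE uniq_roots_dvdp //.
    by apply/allP => _ /mapP[h hU ->]; apply: all_th; rewrite mem_enum in hU.
  by rewrite uniq_rootsE.
pose L0 : fieldExtType K := SubFieldExtType rth irr_q.
pose z : L0 := subfx_root iota theta q.
pose j : {rmorphism L0 -> Ks} := [the {rmorphism L0 -> Ks} of @subfx_inj _ _ iota theta q].
have jA k : j k%:A = iota k by apply: subfx_inj_base.
have jz : j z = theta by apply: subfx_inj_root.
have j_inj : injective j := fmorph_inj j.
have zgen (y : L0) : exists P, y = (map_poly (in_alg L0) P).[z].
  by have [P ->] := subfxEroot rth q0 y; exists P.
have jgen P : j (map_poly (in_alg L0) P).[z] = (map_poly iota P).[theta].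
  by rewrite -horner_map jz -map_poly_comp (eq_map_poly jA).
have fix_th g : fixed (th g).
  by move=> s s1; rewrite -absgalM; apply: eq_on_fixed => //; rewrite rhoM s1 mul1g.
(* Lagrange interpolation: at each conjugate [s theta] the polynomial [h x] takes
   the value [s x] times the derivative of [m], which is the polynomial [h 1].
   Both have invariant coefficients, hence coefficients in [K]. *)
have j_onto x : fixed x -> exists y, j y = x.
  pose N g := \prod_(g' in U | g' != g) ('X - (th g')%:P).
  have sN s g : map_poly s (N g) = N (rho s * g)%g.
    rewrite rmorph_prod /= /N [RHS](reindex_inj (mulgI (rho s))) /=.
    apply: eq_big => [g'|g' /andP[gU _]]; last by rewrite map_polyXsubC /= sth.
    by rewrite groupMl // (inj_eq (mulgI _)).
  pose h w := \sum_(g in U) (lift g w)%:P * N g.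
  have hP w : fixed w -> exists P, j (map_poly (in_alg L0) P).[z] = w * (N 1%g).[theta].
    move=> fw; have [s|P hE] := @fixed_poly (h w).
      rewrite rmorph_sum /= -[RHS](reindexU _ _ _ s (fun g => (lift g w)%:P * N g)).
      apply: eq_bigr => g gU; rewrite rmorphM /= sN map_polyC /= -(absgalM s).
      congr (_%:P * _); apply: eq_on_fixed => //.
      by rewrite rhoM !rho_lift // groupM.
    exists P; rewrite jgen -hE horner_sum (bigD1 1%g) //= hornerM hornerC.
    rewrite lift1 // [X in _ + X]big1 ?addr0 //.
    move=> g /andP[gU g1]; suff N0 : (N g).[theta] = 0 by rewrite hornerM N0 mulr0.
    rewrite horner_prod (bigD1 1%g) /=; last by rewrite group1 eq_sym.
    by rewrite !hornerE [th 1%g]lift1 // subrr mul0r.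
  have N1 : (N 1%g).[theta] != 0.
    rewrite horner_prod; apply/prodf_neq0 => g /andP[gU g1]; rewrite !hornerE subr_eq0.
    by apply: contraNneq g1 => e; apply/eqP/th_inj; rewrite // -e [RHS]lift1 //.
  move=> fx; have [P PE] := hP x fx; have [|Q QE] := hP 1; first by move=> s _; rewrite rmorph1.
  exists ((map_poly (in_alg L0) P).[z] / (map_poly (in_alg L0) Q).[z]).
  by rewrite fmorph_div PE QE mul1r mulfK.
have [zth zthE] : exists zth : gT -> L0, forall g, j (zth g) = th g.
  by have [f fP] := boolp.choice (fun g => j_onto _ (fix_th g)); exists f.
pose mL := map_poly (in_alg L0) q.
have mapj_mL : map_poly j mL = m.
  by rewrite -map_poly_comp qE; apply: eq_map_poly => k /=; rewrite jA.
have mLE : mL = \prod_(x <- [seq zth g | g <- enum U]) ('X - x%:P).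
  apply: (map_poly_inj j); rewrite mapj_mL mE rmorph_prod /= !big_map.
  by apply: eq_bigr => g _; rewrite /= map_polyXsubC /= zthE.
have mL1 : mL \is a polyOver 1%VS by apply: alg_polyOver.
have splitL : splittingFieldFor 1 mL {:L0}.
  exists [seq zth g | g <- enum U]; first by rewrite mLE eqpxx.
  apply/eqP; rewrite eqEsubv subvf /=; apply/subvP => y _.
  have [P ->] := zgen y; apply: rpred_horner.
    by apply: polyOverS (alg_polyOver _ P); apply/subvP/sub1v.
  apply: seqv_sub_adjoin; apply/mapP; exists 1%g; first by rewrite mem_enum group1.
  by apply: j_inj; rewrite jz zthE [RHS]lift1 //.
pose LS := FieldExt_isSplittingField.Build K L0 (ex_intro2 _ _ mL mL1 splitL).
pose L : splittingFieldType K := HB.pack L0 LS.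
have galL : galois 1 {:L}.
  apply/splitting_galoisField; exists mL; split=> //.
  by rewrite -(separable_map j) mapj_mL mE separable_prod_XsubC.
exists L; split=> //; last by exists j => // x /us_fixed; apply: j_onto.
have jfix w : fixed (j w).
  move=> s /fth s1; have [P ->] := zgen w.
  by rewrite jgen -horner_map /= map_poly_absgal s1.
have sgP (x : gal_of {:L}) : exists s : G, forall w : L, j (x w) = s (j w).
  have xz : root mL (x z).
    have -> : mL = map_poly x mL.
      by rewrite -map_poly_comp; apply: eq_map_poly => k; rewrite /= linearZ /= rmorph1.
    rewrite fmorph_root mLE root_prod_XsubC; apply/mapP; exists 1%g.
      by rewrite mem_enum group1.
    by apply: j_inj; rewrite jz zthE [RHS]lift1.
  rewrite mLE root_prod_XsubC in xz; have /mapP[g gU xzE] := xz.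
  exists (lift g) => w; have [P ->] := zgen w.
  rewrite jgen -!horner_map /= map_poly_absgal -[lift g theta]zthE -xzE.
  rewrite -map_poly_comp -map_poly_comp.
  congr _.[_]; apply: eq_map_poly => k /=.
  by rewrite linearZ /= rmorph1 jA.
have [sg sgE] := boolp.choice sgP.
(* Products in the Galois group of [L] compose from left to right and those in
   [G] from right to left, hence the inverse. *)
pose mu (x : gal_of {:L}) := (rho (sg x))^-1%g.
have eq_rho s t : s theta = t theta -> rho s = rho t.
  move=> st; apply/eqP; rewrite eq_mulVg1 -rhoV -rhoM; apply/eqP/th1.
  by rewrite absgalM -st absgalVK.
have muM : {in 'Gal({:L} / 1)%g &, {morph mu : x y / (x * y)%g}}.
  move=> x y _ _; rewrite /mu -invMg -rhoM; congr (_^-1)%g; apply: eq_rho.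
  by rewrite absgalM -jz -!sgE galM ?memvf.
have mu_inj : ('injm (Morphism muM))%g.
  apply/injmP => x y _ _ /invg_inj e; apply/eqP/gal_eqP => w _.
  by apply: j_inj; rewrite !sgE; apply: eq_on_fixed.
apply: (isom_isog (Morphism muM)) => //; apply/isomP; split=> //.
have muU : (Morphism muM @* 'Gal({:L} / 1) \subset U)%g.
  by apply/fintype.subsetP => _ /morphimP[x _ _ ->]; rewrite groupV.
apply/eqP; rewrite eqEcard muU /= card_injm // -(galois_dim galL) dimv1 divn1.
by rewrite dimvf /dim /= szq.
Qed.
End Realization.

(** * Characters with values in [F_p] *)

Section Characters.
Variables (K Ks : fieldType) (iota : {rmorphism K -> Ks}).
Hypothesis sepK : separable_closure iota.
Local Notation G := (absgal iota).
Implicit Types (s t : G).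
Variables (p : nat) (zeta : K).
Hypotheses (p_prime : prime p) (zetaP : p.-primitive_root zeta).

Definition additive_char (chi : G -> 'F_p) :=
  forall s t, chi (s * t)%g = chi s + chi t.

Lemma addchar1 chi : additive_char chi -> chi 1%g = 0.
Proof. by move=> cM; apply: (addrI (chi 1%g)); rewrite -cM mulg1 addr0. Qed.

Lemma addcharV chi s : additive_char chi -> chi (s^-1)%g = - chi s.
Proof. by move=> cM; apply: (addrI (chi s)); rewrite -cM mulgV addchar1 // subrr. Qed.

Lemma addcharX chi s n : additive_char chi -> chi (s ^+ n)%g = chi s *+ n.
Proof.
move=> cM; elim: n => [|n IHn]; first by rewrite expg0 addchar1.
by rewrite expgS cM IHn mulrS.
Qed.

Definition om (x : 'F_p) : Ks := iota zeta ^+ x.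

Let izP : p.-primitive_root (iota zeta).
Proof. by rewrite fmorph_primitive_root. Qed.

Lemma om_nat n : om n%:R = iota zeta ^+ n.
Proof.
by apply/eqP; rewrite (eq_prim_root_expr izP) val_Fp_nat // modn_mod.
Qed.

Lemma omD x y : om (x + y) = om x * om y.
Proof. by rewrite -[x]natr_Zp -[y]natr_Zp -natrD !om_nat exprD. Qed.

Lemma om0 : om 0 = 1.
Proof. by rewrite -[0]/(0%:R) om_nat expr0. Qed.

Lemma om_neq0 x : om x != 0.
Proof.
rewrite expf_neq0 //; apply: contra_eq_neq (prim_expr_order izP) => ->.
by rewrite expr0n gtn_eqF ?(prim_order_gt0 izP) // eq_sym oner_eq0.
Qed.

Lemma omMn x n : om (x * n%:R) = om x ^+ n.
Proof.
elim: n => [|n IHn]; first by rewrite mulr0 om0.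
by rewrite -addn1 natrD mulrDr mulr1 omD IHn exprD expr1.
Qed.

Lemma omXp x : om x ^+ p = 1.
Proof. by rewrite -omMn pchar_Fp_0 // mulr0 om0. Qed.

Lemma om_inj : injective om.
Proof.
move=> x y /eqP; rewrite (eq_prim_root_expr izP).
rewrite !modn_small ?(leq_trans (ltn_ord _)) ?Fp_cast //.
by move=> /eqP/val_inj.
Qed.

Lemma om_fixed s x : s (om x) = om x.
Proof. by rewrite /om rmorphXn /= absgal_iota. Qed.

Lemma om_of_eqX (u v : Ks) : v != 0 -> u ^+ p = v ^+ p -> exists x, u = om x * v.
Proof.
move=> v0 uv; have /(prim_rootP izP)[i ri] : (u / v) ^+ p = 1.
  by rewrite expr_div_n uv divff // expf_neq0.
by exists i%:R; rewrite om_nat -ri divfK.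
Qed.

(** A separable closure is a separable closure of itself, and the root of unity
    makes [X^p - u] separable. *)
Lemma pth_root (u : Ks) : exists r, r ^+ p = u.
Proof.
have [->|u0] := eqVneq u 0.
  by exists 0; rewrite expr0n gtn_eqF // (prim_order_gt0 zetaP).
suff sep : separable_closure (idfun : {rmorphism Ks -> Ks}).
  exact: (kummer_root_exists sep izP u0).
split=> [x|q sq]; last exact: (sepclosure_closed sepK sq).
exists ('X - x%:P); first by have := separable_prod_XsubC [:: x]; rewrite big_seq1.
by rewrite map_poly_id // root_XsubC.
Qed.

(** Linearly independent characters take all tuples of values: their image in
    the space of row vectors is a subspace, and a proper subspace is killed by a
    nonzero linear form. *)
Lemma independent_chars_onto n (chi : 'I_n -> G -> 'F_p) :
  (forall i, additive_char (chi i)) ->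
  (forall k : 'I_n -> 'F_p, (forall s, \sum_i k i * chi i s = 0) -> forall i, k i = 0) ->
  forall v : 'I_n -> 'F_p, exists s, forall i, chi i s = v i.
Proof.
move=> chiM indep v; pose val s : 'rV['F_p]_n := \row_i chi i s.
pose im (u : 'rV['F_p]_n) := exists s, val s = u.
have im0 : im 0 by exists 1%g; apply/rowP => i; rewrite !mxE addchar1.
have imD u u' : im u -> im u' -> im (u + u').
  by move=> [s <-] [t <-]; exists (s * t)%g; apply/rowP => i; rewrite !mxE chiM.
have imZ k u : im u -> im (k *: u).
  by move=> [s <-]; exists (s ^+ k)%g; apply/rowP => i; rewrite !mxE addcharX // -mulr_natl natr_Zp.
pose M := \matrix_(i < #|{: 'rV['F_p]_n}|)
  (if `[< im (enum_val i) >] then enum_val i else 0).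
have imM i : im (row i M) by rewrite rowK; case: asboolP.
have fullM : row_full M.
  rewrite /row_full -mxrank_tr -/(row_free _) -kermx_eq0.
  apply/negPn/negP => /rowV0Pn[k /sub_kermxP kM k0]; case/eqP: k0.
  apply/rowP => i; rewrite mxE; apply: (indep (k 0)) => s.
  have := congr1 (fun w : 'rV_#|{: 'rV['F_p]_n}| => w 0 (enum_rank (val s))) kM.
  rewrite !mxE => e; rewrite -[RHS]e; apply: eq_bigr => l _; rewrite !mxE enum_rankK.
  by case: asboolP => [_|[]]; [rewrite mxE | exists s].
have /submxP[u uE] : (\row_i v i <= M)%MS by apply: submx_full.
have [s sE] : im (\row_i v i).
  rewrite uE mulmx_sum_row; apply: big_ind => // i _; exact: imZ.
by exists s => i; have := congr1 (fun w : 'rV_n => w 0 i) sE; rewrite !mxE.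
Qed.

End Characters.

(** * Norms from vanishing cup products *)

Section OrbitProducts.
Variables (K Ks : fieldType) (iota : {rmorphism K -> Ks}).
Local Notation G := (absgal iota).
Implicit Types (s t : G) (z : Ks).

(** For [n] a multiple of the order of [s] on [z] this is a norm; the partial
    products are the values of the associated cocycle of a cyclic group. *)
Definition orb s n z : Ks := \prod_(k < n) (s ^+ k)%g z.

Lemma orb0 s z : orb s 0 z = 1.
Proof. exact: big_ord0. Qed.

Lemma orbS s n z : orb s n.+1 z = orb s n z * (s ^+ n)%g z.
Proof. exact: big_ord_recr. Qed.

Lemma orb1 s z : orb s 1 z = z.
Proof. by rewrite orbS orb0 mul1r. Qed.

Lemma orbD s m n z : orb s (m + n) z = orb s m z * (s ^+ m)%g (orb s n z).
Proof.
elim: n => [|n IHn]; first by rewrite addn0 orb0 rmorph1 mulr1.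
by rewrite addnS !orbS IHn rmorphM /= mulrA expgD.
Qed.

Lemma orbM s n z z' : orb s n (z * z') = orb s n z * orb s n z'.
Proof. by rewrite -big_split; apply: eq_bigr => k _; rewrite rmorphM. Qed.

Lemma orbV s n z : orb s n z^-1 = (orb s n z)^-1.
Proof. by rewrite -prodfV; apply: eq_bigr => k _; rewrite fmorphV. Qed.

Lemma orb_neq0 s n z : z != 0 -> orb s n z != 0.
Proof. by move=> z0; apply/prodf_neq0 => k _; rewrite fmorph_eq0. Qed.

Lemma orb_shift s n z : orb s n (s z) * z = orb s n z * (s ^+ n)%g z.
Proof.
elim: n => [|n IHn]; first by rewrite !orb0.
by rewrite orbS mulrAC IHn orbS -absgalM -expgSr.
Qed.

Lemma absgal_orb t s n z :
  (forall k, t ((s ^+ k)%g z) = (s ^+ k)%g (t z)) -> t (orb s n z) = orb s n (t z).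
Proof. by move=> ts; rewrite rmorph_prod; apply: eq_bigr => k _; apply: ts. Qed.

Lemma absgalX_fixed s n z : s z = z -> (s ^+ n)%g z = z.
Proof. by move=> sz; elim: n => [|n IHn] //; rewrite expgS absgalM IHn. Qed.

Lemma orb_fixed s n z : s z = z -> orb s n z = z ^+ n.
Proof.
move=> sz; elim: n => [|n IHn]; first by rewrite orb0.
by rewrite orbS IHn absgalX_fixed // -exprSr.
Qed.

End OrbitProducts.

Section Norm.
Variables (K Ks : fieldType) (iota : {rmorphism K -> Ks}).
Hypothesis sepK : separable_closure iota.
Local Notation G := (absgal iota).
Implicit Types (s t : G).
Variables (p : nat) (zeta : K).
Hypotheses (p_prime : prime p) (zetaP : p.-primitive_root zeta).
Local Notation om := (@om _ _ iota p zeta).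

(** If [ca] cup [cb] is the coboundary of [f], then [b = rb ^+ p] is a norm from
    the fixed field of [ca]: [f] is a character on the kernel of [ca], so by
    Hilbert 90 it is the Kummer character of some [m] there, and conjugating by
    [x] shifts it by [cb], so that [rb * m / x m] descends to the fixed field. *)
Lemma norm_of_cup (ca cb f : G -> 'F_p) (rb : Ks) (x : G) (e : seq Ks) :
  additive_char ca -> additive_char cb ->
  rb != 0 -> (forall s, s rb = om (cb s) * rb) ->
  (forall s t, f t - f (s * t)%g + f s = ca s * cb t) ->
  (forall t, {in e, (t : Ks -> Ks) =1 id} -> f t = f 1%g) ->
  ca x = 1 -> cb x = 0 ->
  exists alpha, [/\ alpha != 0, forall s, ca s = 0 -> s alpha = alpha
                  & orb x p alpha = rb ^+ p].
Proof.
move=> caM cbM rb0 rbP fP fe cax cbx.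
have fE s t : f (s * t)%g = f s + f t - ca s * cb t by rewrite -fP; ring.
have f1 : f 1%g = 0.
  by have := fP 1%g 1%g; rewrite mulg1 (addchar1 caM) mul0r subrr add0r.
have [||||m m0 mP] := @hilbert90 _ _ _ sepK [set s | ca s = 0]%classic (om \o f) e.
- by move=> s t /= sH tH; rewrite caM sH tH addr0.
- by move=> s _; apply: om_neq0.
- by move=> s t /= sH _; rewrite fE sH mul0r subr0 omD // om_fixed.
- move=> s t /= sH tH st; congr (om _); have sVt : f (s^-1 * t)%g = 0.
    by rewrite fe // => z ze; rewrite absgalM -st // absgalVK.
  by rewrite -[t](mulKVg s) fE sVt sH mul0r addr0 subr0.
have xm s : ca s = 0 -> s (x m) = om (f s + cb s) * x m.
  move=> sH; pose u := (x^-1 * (s * x))%g.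
  have xu : (x * u)%g = (s * x)%g by rewrite mulKVg.
  have uH : ca u = 0 by rewrite !caM addcharV // sH; ring.
  have fu : f u = f s + cb s.
    have ub : cb u = cb s by rewrite !cbM addcharV // cbx; ring.
    have := fP x u; rewrite xu fE cax cbx sH ub !mul1r mul0r subr0 => e1.
    by rewrite -e1; ring.
  by rewrite -absgalM -xu absgalM (mP u uH) /= fu rmorphM /= om_fixed.
have xm0 : x m != 0 by rewrite fmorph_eq0.
exists (rb * m / x m); split.
- by rewrite !mulf_neq0 // invr_eq0.
- move=> s sH; rewrite fmorph_div rmorphM /= rbP (mP s sH) xm //= omD //.
  by field; rewrite xm0 !om_neq0.
have fX n : f (x ^+ n)%g = f x *+ n.
  elim: n => [|n IHn]; first by rewrite expg0 f1.
  by rewrite expgS fE IHn addcharX // cbx mul0rn mulr0 subr0 mulrS.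
have xpm : (x ^+ p)%g m = m.
  have xpH : ca (x ^+ p)%g = 0 by rewrite addcharX // cax pchar_Fp_0.
  by rewrite (mP _ xpH) /= fX -mulr_natr pchar_Fp_0 // mulr0 om0 // mul1r.
rewrite !orbM orbV orb_fixed ?rbP ?cbx ?om0 ?mul1r //.
have := orb_shift x p m; rewrite xpm => /(mulIf m0) ->.
by rewrite mulfK // orb_neq0.
Qed.

End Norm.

(** * The triple Massey product *)

(** The extension below is built over the fixed field of the kernels of [ca] and
    [cc], on which [s] acts as [x ^+ i * y ^+ j] for any natural numbers [i] and
    [j] lifting [ca s] and [cc s]. The entries are defined by formulas in [i] and
    [j], where cocycle identities hold exactly; periodicity modulo [p] in both
    exponents makes them functions of [s]. *)
Section Massey.
Variables (K Ks : fieldType) (iota : {rmorphism K -> Ks}).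
Hypothesis sepK : separable_closure iota.
Local Notation G := (absgal iota).
Implicit Types (s t : G) (z : Ks) (i j n : nat).
Variables (p : nat) (zeta : K).
Hypotheses (p_prime : prime p) (zetaP : p.-primitive_root zeta).
Local Notation om := (@om _ _ iota p zeta).

Variables (ca cb cc : G -> 'F_p).
Hypotheses (caM : additive_char ca) (ccM : additive_char cc).
Variables (rb : Ks).
Hypotheses (rb0 : rb != 0) (rbP : forall s, s rb = om (cb s) * rb).
Variables (x y : G).
Hypotheses (cax : ca x = 1) (ccx : cc x = 0).
Hypotheses (cay : ca y = 0) (ccy : cc y = 1).
Variables (alpha gamma : Ks).
Hypotheses (alpha0 : alpha != 0) (gamma0 : gamma != 0).
Hypothesis alpha_fix : forall s, ca s = 0 -> s alpha = alpha.
Hypothesis gamma_fix : forall s, cc s = 0 -> s gamma = gamma.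
Hypothesis alpha_norm : orb x p alpha = rb ^+ p.
Hypothesis gamma_norm : orb y p gamma = rb ^+ p.
Variable us : seq Ks.
Hypothesis us_ac : forall s t, {in us, (s : Ks -> Ks) =1 t} -> ca s = ca t /\ cc s = cc t.

Local Notation X i := (x ^+ i)%g.
Local Notation Y j := (y ^+ j)%g.

Definition in_ac z := forall s, ca s = 0 -> cc s = 0 -> s z = z.

Lemma ac_eq z s t : in_ac z -> ca s = ca t -> cc s = cc t -> s z = t z.
Proof.
move=> zE as_t cs_t; rewrite -[s z](absgalKV t) -(absgalM (t^-1)%g) zE //.
  by rewrite caM addcharV // as_t addNr.
by rewrite ccM addcharV // cs_t addNr.
Qed.

Lemma ac_comm z s t : in_ac z -> s (t z) = t (s z).
Proof.
by move=> zE; rewrite -!absgalM; apply: ac_eq; rewrite // ?caM ?ccM addrC.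
Qed.

Lemma ac_img z s : in_ac z -> in_ac (s z).
Proof. by move=> zE t ta tc; rewrite ac_comm // zE. Qed.

Lemma ac_orb z s n : in_ac z -> in_ac (orb s n z).
Proof.
move=> zE t ta tc; rewrite rmorph_prod; apply: eq_bigr => k _.
exact: (ac_img (s ^+ k)%g zE).
Qed.

Lemma ac_mul z z' : in_ac z -> in_ac z' -> in_ac (z * z').
Proof. by move=> zE zE' t ta tc; rewrite rmorphM /= zE ?zE'. Qed.

Lemma ac_inv z : in_ac z -> in_ac z^-1.
Proof. by move=> zE t ta tc; rewrite fmorphV /= zE. Qed.

Lemma ac_act z s i j :
  in_ac z -> ca s = i%:R -> cc s = j%:R -> s z = X i (Y j z).
Proof.
move=> zE si sj; rewrite -absgalM; apply: ac_eq => //.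
  by rewrite caM !addcharX // cax cay mul0rn addr0.
by rewrite ccM !addcharX // ccx ccy mul0rn add0r.
Qed.

Lemma alpha_ac : in_ac alpha. Proof. by move=> s sa _; apply: alpha_fix. Qed.
Lemma gamma_ac : in_ac gamma. Proof. by move=> s _ sc; apply: gamma_fix. Qed.

Let a_ i := orb x i alpha.
Let c_ j := orb y j gamma.

Lemma a_fix s i : ca s = 0 -> s (a_ i) = a_ i.
Proof.
move=> sa; rewrite /a_ absgal_orb => [|k]; first by rewrite alpha_fix.
by apply/ac_comm/alpha_ac.
Qed.

Lemma c_fix s j : cc s = 0 -> s (c_ j) = c_ j.
Proof.
move=> sc; rewrite /c_ absgal_orb => [|k]; first by rewrite gamma_fix.
by apply/ac_comm/gamma_ac.
Qed.

Lemma period_mod (F : nat -> Ks) n :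
  (forall n, F (n + p)%N = F n) -> F (n%:R : 'F_p) = F n.
Proof.
move=> Fp; rewrite val_Fp_nat // {2}(divn_eq n p).
elim: (n %/ p)%N => [|q IHq]; first by rewrite mul0n.
by rewrite mulSn -addnA addnC Fp.
Qed.

(** The two solutions of the norm equation differ by an element of norm 1 under
    [x * y]; Hilbert 90 makes it a quotient of conjugates. *)
Lemma norm_quotient : exists e, [/\ e != 0, in_ac e & y (x e) = e * gamma / alpha].
Proof.
pose d := gamma / alpha; pose F n := orb (x * y)%g n d.
have d_ac : in_ac d by apply: ac_mul; [apply: gamma_ac | apply/ac_inv/alpha_ac].
have Fper n : F (n + p)%N = F n.
  rewrite /F orbD; suff -> : orb (x * y)%g p d = 1 by rewrite rmorph1 mulr1.
  rewrite orbM orbV.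
  have -> : orb (x * y)%g p gamma = orb y p gamma.
    apply: eq_bigr => k _; rewrite -[LHS](absgalKV (y ^+ k)%g) -(absgalM (y ^+ k)^-1%g).
    by rewrite gamma_fix // ccM addcharV // !addcharX // ccM ccx add0r addNr.
  have -> : orb (x * y)%g p alpha = orb x p alpha.
    apply: eq_bigr => k _; rewrite -[LHS](absgalKV (x ^+ k)%g) -(absgalM (x ^+ k)^-1%g).
    by rewrite alpha_fix // caM addcharV // !addcharX // caM cay addr0 addNr.
  by rewrite alpha_norm gamma_norm divff // expf_neq0.
have F_ac n : in_ac (F n) by apply: ac_orb.
have [||||e e0 eP] := @hilbert90 _ _ _ sepK [set s | ca s = cc s]%classic (fun s => F (ca s)) us.
- by move=> s t /= sH tH; rewrite caM ccM sH tH.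
- by move=> s _; rewrite orb_neq0 // mulf_neq0 ?invr_eq0.
- move=> s t /= sH tH; rewrite caM -{1}[ca s]natr_Zp -{1}[ca t]natr_Zp -natrD.
  rewrite period_mod // /F orbD; congr (_ * _); apply: ac_eq; first exact: F_ac.
    by rewrite addcharX // caM cax cay addr0 natr_Zp.
  by rewrite addcharX // ccM ccx ccy add0r natr_Zp.
- by move=> s t _ _ /us_ac[-> _].
have e_ac : in_ac e by move=> s sa sc; rewrite eP /= ?sa ?sc // /F orb0 mul1r.
exists e; split=> //; rewrite (ac_comm y x e_ac) -absgalM eP /=.
  by rewrite caM cax cay addr0 -[1]/(1%:R) period_mod // /F orb1 /d; field.
by rewrite caM ccM cax cay ccx ccy addr0 add0r.
Qed.

Section Entries.
Variable e : Ks.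
Hypotheses (e0 : e != 0) (e_ac : in_ac e) (exy : y (x e) = e * gamma / alpha).

Let P_ i := orb x i (x e).
Let Q_ j := orb y j e.
Let B := rb ^+ p.

Lemma a_neq0 i : a_ i != 0. Proof. exact: orb_neq0. Qed.
Lemma c_neq0 j : c_ j != 0. Proof. exact: orb_neq0. Qed.
Lemma Q_neq0 j : Q_ j != 0. Proof. exact: orb_neq0. Qed.
Lemma P_neq0 i : P_ i != 0. Proof. by apply: orb_neq0; rewrite fmorph_eq0. Qed.

Lemma B_fix s : s B = B.
Proof. by rewrite rmorphXn /= rbP exprMn omXp // mul1r. Qed.

Lemma P_ac i : in_ac (P_ i). Proof. exact/ac_orb/ac_img. Qed.
Lemma Q_ac j : in_ac (Q_ j). Proof. exact: ac_orb. Qed.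
Lemma a_ac i : in_ac (a_ i). Proof. exact/ac_orb/alpha_ac. Qed.
Lemma c_ac j : in_ac (c_ j). Proof. exact/ac_orb/gamma_ac. Qed.

Lemma caX i : ca (X i) = i%:R. Proof. by rewrite addcharX // cax. Qed.
Lemma ccX i : cc (X i) = 0. Proof. by rewrite addcharX // ccx mul0rn. Qed.
Lemma caY j : ca (Y j) = 0. Proof. by rewrite addcharX // cay mul0rn. Qed.
Lemma ccY j : cc (Y j) = j%:R. Proof. by rewrite addcharX // ccy. Qed.

Lemma Xp z : in_ac z -> X p z = z.
Proof. by move=> zE; apply: zE; rewrite ?caX ?ccX // pchar_Fp_0. Qed.

Lemma Yp z : in_ac z -> Y p z = z.
Proof. by move=> zE; apply: zE; rewrite ?caY ?ccY // pchar_Fp_0. Qed.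

Lemma P_shift i : orb x i e = P_ i * e / X i e.
Proof. by rewrite orb_shift mulfK // fmorph_eq0. Qed.

Lemma y_P i : y (P_ i) = P_ i * (e / X i e) * (gamma ^+ i / a_ i).
Proof.
rewrite /P_ absgal_orb => [|k]; last exact/ac_comm/ac_img/e_ac.
rewrite exy !orbM orbV P_shift (@orb_fixed _ _ _ x i gamma) ?gamma_fix //.
by rewrite !mulrA.
Qed.

Lemma YP i j : Y j (P_ i) = P_ i * (Q_ j / X i (Q_ j)) * (c_ j ^+ i / a_ i ^+ j).
Proof.
elim: j => [|j IHj].
  by rewrite /Q_ /c_ !orb0 expr0 expr1n rmorph1 !divr1 !mulr1.
rewrite expgSr absgalM y_P !rmorphM !fmorphV /= IHj rmorphXn /=.
rewrite (a_fix i (caY j)) [in RHS]/Q_ [in RHS]/c_ !orbS -/(Q_ j) -/(c_ j).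
rewrite rmorphM /= exprMn (ac_comm (Y j) (X i) e_ac) exprSr.
by field; rewrite !fmorph_eq0 ?expf_neq0 ?a_neq0 ?Q_neq0 ?e0.
Qed.

(** The correction making the [p]-th powers of the entries below a cocycle. *)
Let T i j := P_ i / (a_ i ^+ j * X i (Q_ j)).

Lemma T_neq0 i j : T i j != 0.
Proof.
by rewrite mulf_neq0 ?P_neq0 // invr_eq0 mulf_neq0 ?expf_neq0 ?a_neq0 // fmorph_eq0 Q_neq0.
Qed.

(** The factors produced by commuting [y] past [P_ i] cancel those produced by
    commuting [x] past [Q_ j]: this is where the relation between [e], [alpha] and
    [gamma] is used. *)
Lemma TD i j i' j' :
  T (i + i') (j + j') = T i j / (c_ j ^+ i' * a_ i ^+ j') * X i (Y j (T i' j')).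
Proof.
have PD : P_ (i + i') = P_ i * X i (P_ i') by apply: orbD.
have QD : Q_ (j + j') = Q_ j * Y j (Q_ j') by apply: orbD.
have aD : a_ (i + i') = a_ i * X i (a_ i') by apply: orbD.
have -> : X i (Y j (T i' j')) = X i (P_ i') * (X i (Q_ j) / X i (X i' (Q_ j))) *
    (c_ j ^+ i' / X i (a_ i') ^+ j) / (X i (a_ i') ^+ j' * X i (X i' (Y j (Q_ j')))).
  rewrite /T fmorph_div rmorphM rmorphXn /= (a_fix i' (caY j)) YP.
  rewrite (ac_comm (Y j) _ (Q_ac j')) !rmorphM !fmorphV !rmorphM !rmorphXn /=.
  by rewrite (c_fix j (ccX i)).
rewrite /T PD QD aD expgD absgalM !rmorphM /= exprMn !exprD.
field.
by rewrite !fmorph_eq0 !expf_neq0 ?fmorph_eq0 ?a_neq0 ?c_neq0 ?Q_neq0.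
Qed.

Lemma orb_period s z : (s ^+ p)%g z = z -> orb s p (s z) = orb s p z.
Proof.
have [->|z0] := eqVneq z 0; first by rewrite !raddf0.
by move=> sz; apply: (mulIf z0); rewrite orb_shift sz.
Qed.

(** [Q_ p] is the norm of [e] under [y], and [P_ p] its norm under [x]. The next
    lemmas say that [Q_ p] and the inverse of [P_ p] transform like elements whose
    [p]-th roots, together with [rb], realize the Heisenberg extensions attached
    to the two cup products. *)
Lemma XA i : X i (Q_ p) = Q_ p * B ^+ i / a_ i ^+ p.
Proof.
elim: i => [|i IHi]; first by rewrite /a_ orb0 expr1n divr1 mulr1.
have xA : x (Q_ p) = Q_ p * B / alpha ^+ p.
  rewrite /Q_ absgal_orb => [|k]; last exact/ac_comm/e_ac.
  rewrite -orb_period; last exact/Yp/ac_img/e_ac.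
  by rewrite exy !orbM orbV gamma_norm (@orb_fixed _ _ _ y p alpha) ?alpha_fix.
rewrite expgSr absgalM xA !rmorphM fmorphV rmorphXn /= IHi B_fix /a_ orbS exprS exprMn.
by rewrite -/(a_ i); field; rewrite !expf_neq0 ?fmorph_eq0 ?a_neq0.
Qed.

Lemma YA j : Y j (Q_ p) = Q_ p.
Proof.
apply: absgalX_fixed; rewrite /Q_ absgal_orb => [|k]; last exact/ac_comm/e_ac.
exact/orb_period/Yp.
Qed.

Lemma YD j : Y j (P_ p) = P_ p * c_ j ^+ p / B ^+ j.
Proof.
by rewrite YP (Xp (Q_ac j)) divff ?Q_neq0 // mulr1 /a_ alpha_norm mulrA.
Qed.

Lemma XD i : X i (P_ p) = P_ p.
Proof.
apply: absgalX_fixed; rewrite /P_ absgal_orb => [|k]; last exact/ac_comm/ac_img/e_ac.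
exact/orb_period/Xp/ac_img.
Qed.

Lemma a_period i : a_ (i + p) = B * a_ i.
Proof. by rewrite addnC [LHS]orbD -/(a_ i) (Xp (a_ac i)) [orb x p _]alpha_norm. Qed.

Lemma c_period j : c_ (j + p) = B * c_ j.
Proof. by rewrite addnC [LHS]orbD -/(c_ j) (Yp (c_ac j)) [orb y p _]gamma_norm. Qed.

Lemma a_eq s i n : ca s = i%:R -> s (a_ n) = X i (a_ n).
Proof.
move=> si; rewrite -[LHS](absgalKV (X i)) -(absgalM (X i)^-1%g) a_fix //.
by rewrite caM addcharV // caX si addNr.
Qed.

Lemma c_eq s j n : cc s = j%:R -> s (c_ n) = Y j (c_ n).
Proof.
move=> sj; rewrite -[LHS](absgalKV (Y j)) -(absgalM (Y j)^-1%g) c_fix //.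
by rewrite ccM addcharV // ccY sj addNr.
Qed.

(** The cochains are the Kummer cochains of [p]-th roots [rA], [rC] and [rd] of
    the norm of [e] under [y], the inverse of its norm under [x], and an element
    [d] given by Hilbert 90: the quotient [s rd / rd] is forced up to a power of
    the root of unity, and its [p]-th power turns out to be a cocycle. *)
Theorem massey_cochains : exists (phi psi g : G -> 'F_p) (rA rC rd : Ks),
  [/\ forall s t, phi (s * t)%g = phi s + phi t + cb s * ca t,
      forall s t, psi (s * t)%g = psi s + psi t + cb s * cc t,
      forall s t, g (s * t)%g = g s + g t + psi s * ca t + phi s * cc t + cb s * ca t * cc t,
      [/\ rA != 0, rC != 0 & rd != 0]
    & forall s, ca s = 0 -> cc s = 0 ->
      [/\ s rA = om (phi s) * rA, s rC = om (psi s) * rC & s rd = om (g s) * rd]].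
Proof.
have p0 : (0 < p)%N := prime_gt0 p_prime.
have natval (u : 'F_p) : u = (u : nat)%:R by rewrite natr_Zp.
have root0 (u r : Ks) : u != 0 -> r ^+ p = u -> r != 0.
  by move=> u0 ru; move: u0; rewrite -ru expf_eq0 p0.
have [rA rAp] := pth_root sepK zetaP (Q_ p).
have [rC rCp] := pth_root sepK zetaP (P_ p)^-1.
have rA0 : rA != 0 by apply: root0 rAp; apply: Q_neq0.
have rC0 : rC != 0 by apply: root0 rCp; rewrite invr_eq0 P_neq0.
pose RA i := rA * rb ^+ i / a_ i.
pose RC j := rC * rb ^+ j / c_ j.
have RA0 i : RA i != 0 by rewrite !mulf_neq0 ?invr_eq0 ?expf_neq0 ?a_neq0.
have RC0 j : RC j != 0 by rewrite !mulf_neq0 ?invr_eq0 ?expf_neq0 ?c_neq0.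
have RA_per i : RA (i + p)%N = RA i.
  by rewrite /RA a_period exprD -/B; field; rewrite a_neq0 expf_neq0.
have RC_per j : RC (j + p)%N = RC j.
  by rewrite /RC c_period exprD -/B; field; rewrite c_neq0 expf_neq0.
have phi_ex s : exists u, s rA = om u * RA (ca s).
  apply: om_of_eqX => //; rewrite ?RA0 //.
  rewrite -rmorphXn rAp /= (ac_act (Q_ac p) (natval (ca s)) (natval (cc s))) YA XA.
  by rewrite /RA expr_div_n exprMn rAp /B exprAC.
have [phi phiE] := boolp.choice phi_ex.
have psi_ex s : exists u, s rC = om u * RC (cc s).
  apply: om_of_eqX => //; rewrite ?RC0 //.
  rewrite -rmorphXn rCp /= fmorphV /= (ac_act (P_ac p) (natval (ca s)) (natval (cc s))).
  rewrite ac_comm ?XD ?YD; last exact: P_ac.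
  rewrite /RC expr_div_n exprMn rCp /B [_ ^+ p ^+ _]exprAC.
  by field; rewrite P_neq0 !expf_neq0 ?c_neq0.
have [psi psiE] := boolp.choice psi_ex.
have phiP s i : ca s = i%:R -> s rA = om (phi s) * RA i.
  by move=> si; rewrite phiE si period_mod.
have psiP s j : cc s = j%:R -> s rC = om (psi s) * RC j.
  by move=> sj; rewrite psiE sj period_mod.
have rbX s n : s (rb ^+ n) = om (cb s * n%:R) * rb ^+ n.
  by rewrite rmorphXn /= rbP exprMn omMn.
have RA_step s i i' : ca s = i%:R -> s (RA i') = om (phi s + cb s * i'%:R) * RA (i + i')%N.
  move=> si; rewrite fmorph_div rmorphM /= (phiP s i si) rbX (a_eq i' si) omD //.
  rewrite /RA [a_ (i + i')]orbD -/(a_ i) -/(a_ i') exprD.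
  by field; rewrite fmorph_eq0 !a_neq0.
have RC_step s j j' : cc s = j%:R -> s (RC j') = om (psi s + cb s * j'%:R) * RC (j + j')%N.
  move=> sj; rewrite fmorph_div rmorphM /= (psiP s j sj) rbX (c_eq j' sj) omD //.
  rewrite /RC [c_ (j + j')]orbD -/(c_ j) -/(c_ j') exprD.
  by field; rewrite fmorph_eq0 !c_neq0.
pose R i j := rC ^+ i * rA ^+ j * rb ^+ (i * j) * T i j.
have R0 i j : R i j != 0 by rewrite mulf_neq0 ?T_neq0 // !mulf_neq0 ?expf_neq0.
have R_step s i j i' j' : ca s = i%:R -> cc s = j%:R ->
    R i j * s (R i' j') =
    om (psi s * i'%:R + phi s * j'%:R + cb s * (i' * j')%:R) * R (i + i')%N (j + j')%N.
  have sR : s (R i' j') =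
      s rC ^+ i' * s rA ^+ j' * s (rb ^+ (i' * j')) * s (T i' j').
    by rewrite /R; move: (T i' j') => u; rewrite !rmorphM /= !rmorphXn.
  move=> si sj; rewrite sR (psiP s j sj) (phiP s i si) rbX.
  have T_ac : in_ac (T i' j').
    by apply/ac_mul/ac_inv/ac_mul; [apply: P_ac| |apply/ac_img/Q_ac] => t *;
       rewrite rmorphXn /= a_ac.
  rewrite (ac_act T_ac si sj) !omD // !omMn // /R TD /RA /RC !exprMn !exprVn.
  rewrite mulnDl !mulnDr !exprD -!exprM [(j * i')%N]mulnC.
  by field; rewrite !expf_neq0 ?a_neq0 ?c_neq0.
have T_p0 : T p 0 = P_ p.
  by rewrite /T /Q_ orb0 expr0 mul1r rmorph1 divr1.
have T_0p : T 0 p = (Q_ p)^-1.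
  by rewrite /T /P_ /a_ !orb0 expr1n !mul1r.
have R_perl i j : R (i + p)%N j = R i j.
  have := TD i j p 0; rewrite addn0 => TE; rewrite /R TE T_p0 YD !rmorphM fmorphV /=.
  have BX : X i (B ^+ j) = B ^+ j by rewrite rmorphXn /= B_fix.
  have cX : X i (c_ j ^+ p) = c_ j ^+ p by rewrite rmorphXn /= (c_fix j (ccX i)).
  have bD : rb ^+ ((i + p) * j) = rb ^+ (i * j) * B ^+ j.
    by rewrite mulnDl exprD [rb ^+ (p * j)]exprM.
  rewrite XD BX cX bD exprD rCp expr0 mulr1.
  by field; rewrite P_neq0 !expf_neq0 ?c_neq0.
have R_perr i j : R i (j + p)%N = R i j.
  have := TD i j 0 p; rewrite addn0 => TE; rewrite /R TE T_0p !fmorphV /= YA XA.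
  have bD : rb ^+ (i * (j + p)) = rb ^+ (i * j) * B ^+ i.
    by rewrite mulnDr exprD [(i * p)%N]mulnC [rb ^+ (p * i)]exprM.
  rewrite bD exprD rAp expr0 mul1r.
  by field; rewrite Q_neq0 !expf_neq0 ?a_neq0.
have R_val i j : R (i%:R : 'F_p) (j%:R : 'F_p) = R i j.
  by rewrite (@period_mod (fun n => R n _)) // (@period_mod (R i)).
have [||||d d0 dP] := @hilbert90 _ _ _ sepK setT (fun s => R (ca s) (cc s) ^+ p) us.
- by [].
- by move=> s _; rewrite expf_neq0.
- move=> s t _ _; rewrite rmorphXn -exprMn /=.
  rewrite (R_step s _ _ _ _ (natval (ca s)) (natval (cc s))) [in RHS]exprMn omXp // mul1r.
  by rewrite -[in RHS]R_val !natrD -!natval -caM -ccM.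
- by move=> s t _ _ /us_ac[-> ->].
have [rd rdp] := pth_root sepK zetaP d.
have rd0 : rd != 0 by apply: root0 rdp.
have g_ex s : exists u, s rd = om u * (rd * R (ca s) (cc s)).
  apply: om_of_eqX => //; first by rewrite mulf_neq0.
  by rewrite -(rmorphXn s) rdp [in RHS]exprMn rdp /= dP // mulrC.
have [g gE] := boolp.choice g_ex.
have gP s i j : ca s = i%:R -> cc s = j%:R -> s rd = om (g s) * (rd * R i j).
  by move=> si sj; rewrite gE si sj R_val.
exists phi, psi, g, rA, rC, rd; split=> //.
- move=> s t; set i := (ca s : nat); set i' := (ca t : nat).
  have si : ca s = i%:R by rewrite -natval.
  have ti : ca t = i'%:R by rewrite -natval.
  apply: (@om_inj _ _ iota _ _ p_prime zetaP); apply: (mulIf (RA0 (i + i')%N)).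
  rewrite -(phiP (s * t)%g); last by rewrite caM natrD -si -ti.
  rewrite absgalM (phiP t i' ti) (rmorphM s) /= om_fixed (RA_step s i i' si).
  by rewrite ti !omD //; ring.
- move=> s t; set j := (cc s : nat); set j' := (cc t : nat).
  have sj : cc s = j%:R by rewrite -natval.
  have tj : cc t = j'%:R by rewrite -natval.
  apply: (@om_inj _ _ iota _ _ p_prime zetaP); apply: (mulIf (RC0 (j + j')%N)).
  rewrite -(psiP (s * t)%g); last by rewrite ccM natrD -sj -tj.
  rewrite absgalM (psiP t j' tj) (rmorphM s) /= om_fixed (RC_step s j j' sj).
  by rewrite tj !omD //; ring.
- move=> s t; set i := (ca s : nat); set i' := (ca t : nat).
  set j := (cc s : nat); set j' := (cc t : nat).
  have si : ca s = i%:R by rewrite -natval.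
  have sj : cc s = j%:R by rewrite -natval.
  have ti : ca t = i'%:R by rewrite -natval.
  have tj : cc t = j'%:R by rewrite -natval.
  apply: (@om_inj _ _ iota _ _ p_prime zetaP).
  apply: (mulIf (_ : rd * R (i + i')%N (j + j')%N != 0)); first by rewrite mulf_neq0.
  rewrite -(gP (s * t)%g); try by rewrite ?caM ?ccM natrD -?si -?sj -?ti -?tj.
  rewrite absgalM (gP t i' j') // (rmorphM s) (rmorphM s rd) /= om_fixed (gP s i j) //.
  have -> : g s + g t + psi s * ca t + phi s * cc t + cb s * ca t * cc t =
     g s + g t + (psi s * i'%:R + phi s * j'%:R + cb s * (i' * j')%:R).
    by rewrite natrM -ti -tj; ring.
  set u := psi s * _ + _ + _.
  transitivity (om (g t) * om (g s) * rd * (R i j * s (R i' j'))); first by ring.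
  by rewrite (R_step s i j i' j' si sj) !omD //; ring.
- have RA00 : RA 0 = rA by rewrite /RA /a_ orb0 expr0 mulr1 divr1.
  have RC00 : RC 0 = rC by rewrite /RC /c_ orb0 expr0 mulr1 divr1.
  have R00 : R 0 0 = 1.
    rewrite /R muln0 !expr0 /T /P_ /Q_ !orb0 expr0 rmorph1.
    by rewrite !mul1r invr1.
  move=> s sa sc; rewrite (phiP s 0) ?sa // (psiP s 0) ?sc // (gP s 0 0) ?sa ?sc //.
  by rewrite RA00 RC00 R00 mulr1.
Qed.

End Entries.
End Massey.

(** * Unitriangular matrices of size 4 *)

Section Unitriangular4.
Variable p : nat.
Implicit Types a b : 'F_p.

Definition u4mx a12 a23 a34 a13 a24 a14 : 'M['F_p]_4 :=
  \matrix_(i, j) nth 0 (nth [::] [:: [:: 1; a12; a13; a14]; [:: 0; 1; a23; a24];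
                                     [:: 0; 0; 1; a34]; [:: 0; 0; 0; 1]] i) j.

Lemma u4mxM a12 a23 a34 a13 a24 a14 b12 b23 b34 b13 b24 b14 :
  u4mx a12 a23 a34 a13 a24 a14 *m u4mx b12 b23 b34 b13 b24 b14 =
  u4mx (a12 + b12) (a23 + b23) (a34 + b34) (a13 + b13 + a12 * b23)
       (a24 + b24 + a23 * b34) (a14 + b14 + a12 * b24 + a13 * b34).
Proof.
apply/matrixP => [[[|[|[|[|?]]]] Hi] [[|[|[|[|?]]]] Hj]] //;
  by rewrite !mxE !big_ord_recl big_ord0 !mxE /=; ring.
Qed.

Lemma u4mx0 : u4mx 0 0 0 0 0 0 = 1.
Proof.
by apply/matrixP => [[[|[|[|[|?]]]] Hi] [[|[|[|[|?]]]] Hj]] //; rewrite !mxE.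
Qed.

Lemma u4mx_unit a12 a23 a34 a13 a24 a14 :
  u4mx a12 a23 a34 a13 a24 a14 \is a GRing.unit.
Proof.
have : u4mx a12 a23 a34 a13 a24 a14 *m
    u4mx (- a12) (- a23) (- a34) (a12 * a23 - a13) (a23 * a34 - a24)
      (a13 * a34 - a12 * (a23 * a34 - a24) - a14) = 1%:M.
  by rewrite u4mxM -[RHS]/(1 : 'M['F_p]_4) -u4mx0; congr u4mx; ring.
by case/mulmx1_unit.
Qed.

Definition u4 a12 a23 a34 a13 a24 a14 : {'GL_4(p)} :=
  FinRing.Unit (u4mx_unit a12 a23 a34 a13 a24 a14).

Lemma u4P (g : {'GL_4(p)}) : g \in unitriangular 4 p ->
  exists a12 a23 a34 a13 a24 a14, g = u4 a12 a23 a34 a13 a24 a14.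
Proof.
move=> /unitriangularP gU; pose o k (h : (k < 4)%N) : 'I_4.-1.+1 := Ordinal h.
pose ent k l (hk : (k < 4)%N) (hl : (l < 4)%N) : 'F_p := GLval g (o k hk) (o l hl).
exists (ent 0 1 isT isT), (ent 1 2 isT isT), (ent 2 3 isT isT)%N.
exists (ent 0 2 isT isT), (ent 1 3 isT isT), (ent 0 3 isT isT)%N.
apply/val_inj/matrixP => i j; rewrite /= mxE.
have [ji|ij] := leqP j i.
  rewrite gU //; move: i j ji => [[|[|[|[|?]]]] Hi] [[|[|[|[|?]]]] Hj] //=.
by move: i j ij => [[|[|[|[|?]]]] Hi] [[|[|[|[|?]]]] Hj] //= _;
  congr (GLval g _ _); apply: val_inj.
Qed.

Lemma u4_in a12 a23 a34 a13 a24 a14 : u4 a12 a23 a34 a13 a24 a14 \in unitriangular 4 p.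
Proof.
apply/unitriangularP => i j; rewrite /= mxE.
by move: i j => [[|[|[|[|?]]]] Hi] [[|[|[|[|?]]]] Hj] //=.
Qed.

Lemma u4M a12 a23 a34 a13 a24 a14 b12 b23 b34 b13 b24 b14 :
  (u4 a12 a23 a34 a13 a24 a14 * u4 b12 b23 b34 b13 b24 b14)%g =
  u4 (a12 + b12) (a23 + b23) (a34 + b34) (a13 + b13 + a12 * b23)
     (a24 + b24 + a23 * b34) (a14 + b14 + a12 * b24 + a13 * b34).
Proof. by apply: val_inj; apply: u4mxM. Qed.

Lemma u4_eq1 a12 a23 a34 a13 a24 a14 : u4 a12 a23 a34 a13 a24 a14 = 1%g <->
  [/\ a12 = 0, a23 = 0 & a34 = 0] /\ [/\ a13 = 0, a24 = 0 & a14 = 0].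
Proof.
split=> [/(congr1 val)|[[-> -> ->] [-> -> ->]]]; last exact/val_inj/u4mx0.
move=> /= /matrixP E; pose o k (h : (k < 4)%N) : 'I_4 := Ordinal h.
have := (E (o 0%N isT) (o 1%N isT), E (o 0%N isT) (o 2%N isT), E (o 0%N isT) (o 3%N isT)).
have := (E (o 1%N isT) (o 2%N isT), E (o 1%N isT) (o 3%N isT), E (o 2%N isT) (o 3%N isT)).
by rewrite !mxE /= => -[[-> ->] ->] [[-> ->] ->].
Qed.

End Unitriangular4.

(** The superdiagonal is the Frattini quotient of the unitriangular group, so
    surjectivity there suffices: commutators of elements lifting the three
    elementary superdiagonal matrices supply the remaining entries. *)
Lemma u4_entries_onto (G : groupType) (p : nat) (ca cb cc f h g : G -> 'F_p) :
  prime p ->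
  (forall s t, ca (s * t)%g = ca s + ca t) ->
  (forall s t, cb (s * t)%g = cb s + cb t) ->
  (forall s t, cc (s * t)%g = cc s + cc t) ->
  (forall s t, f (s * t)%g = f s + f t + ca s * cb t) ->
  (forall s t, h (s * t)%g = h s + h t + cb s * cc t) ->
  (forall s t, g (s * t)%g = g s + g t + ca s * h t + f s * cc t) ->
  (forall u v w, exists s, [/\ ca s = u, cb s = v & cc s = w]) ->
  forall u v w u' v' w', exists s,
    [/\ ca s = u, cb s = v & cc s = w] /\ [/\ f s = u', h s = v' & g s = w'].
Proof.
move=> p_prime aM bM cM fM hM gM onto u v w u' v' w'.
have c0 (chi : G -> 'F_p) : (forall s t, chi (s * t)%g = chi s + chi t) -> chi 1%g = 0.
  by move=> M; apply: (addrI (chi 1%g)); rewrite -M mulg1 addr0.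
have [x1 [a1 b1 c1]] := onto 1 0 0.
have [x2 [a2 b2 c2]] := onto 0 1 0.
have [x3 [a3 b3 c3]] := onto 0 0 1.
pose in0 s := [/\ ca s = 0, cb s = 0 & cc s = 0].
have comm0 s t : exists r, in0 r /\ (r * (t * s) = s * t)%g.
  exists (s * t * (t * s)^-1)%g; rewrite mulgKV; split=> //.
  have cV (chi : G -> 'F_p) : (forall s t, chi (s * t)%g = chi s + chi t) ->
      chi (s * t * (t * s)^-1)%g = 0.
    move=> M; apply: (addIr (chi (t * s)%g)).
    by rewrite -M mulgKV !M add0r addrC.
  by split; apply: cV.
have f1 : f 1%g = 0.
  by apply: (addrI (f 1%g)); have := fM 1%g 1%g; rewrite mulg1 (c0 _ aM) mul0r !addr0 => <-.
have h1 : h 1%g = 0.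
  by apply: (addrI (h 1%g)); have := hM 1%g 1%g; rewrite mulg1 (c0 _ bM) mul0r !addr0 => <-.
have g1 : g 1%g = 0.
  apply: (addrI (g 1%g)); have := gM 1%g 1%g.
  by rewrite mulg1 (c0 _ aM) (c0 _ cM) mul0r mulr0 !addr0 => <-.
have pow s n : in0 s ->
    [/\ in0 (s ^+ n)%g, f (s ^+ n)%g = f s *+ n & h (s ^+ n)%g = h s *+ n].
  move=> [sa sb sc]; elim: n => [|n [[na nb nc] IHf IHh]].
    by rewrite expg0 f1 h1; do !split; apply: c0.
  rewrite expgS fM hM sa sb IHf IHh !mul0r !addr0 !mulrS; do !split=> //.
  - by rewrite aM sa na addr0.
  - by rewrite bM sb nb addr0.
  - by rewrite cM sc nc addr0.
have [w12 [[wa wb wc] wE]] := comm0 x1 x2.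
have [w23 [[va vb vc] vE]] := comm0 x2 x3.
have [z [[za zb zc] zE]] := comm0 w12 x3.
have fw : f w12 = 1.
  have := congr1 f wE; rewrite !fM wa a1 a2 b1 b2.
  by rewrite !(mul0r, mulr0, mul1r, addr0) => /(canRL (addrK _)) ->; ring.
have hw : h w12 = 0.
  have := congr1 h wE; rewrite !hM wb b1 b2 c1 c2.
  by rewrite !(mul0r, mulr0, mul1r, addr0) => /(canRL (addrK _)) ->; ring.
have fv : f w23 = 0.
  have := congr1 f vE; rewrite !fM va a2 a3 b2 b3.
  by rewrite !(mul0r, mulr0, mul1r, addr0) => /(canRL (addrK _)) ->; ring.
have hv : h w23 = 1.
  have := congr1 h vE; rewrite !hM vb b2 b3 c2 c3.
  by rewrite !(mul0r, mulr0, mul1r, addr0) => /(canRL (addrK _)) ->; ring.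
have fz : f z = 0.
  have := congr1 f zE; rewrite !fM za wa a3 wb b3.
  by rewrite !(mul0r, mulr0, mul1r, addr0) => /(canRL (addrK _)) ->; ring.
have hz : h z = 0.
  have := congr1 h zE; rewrite !hM zb wb b3 wc c3.
  by rewrite !(mul0r, mulr0, mul1r, addr0) => /(canRL (addrK _)) ->; ring.
have gz : g z = 1.
  have := congr1 g zE; rewrite !gM za fz wa a3 fw hw c3 wc.
  by rewrite !(mul0r, mulr0, mul1r, addr0) => /(canRL (addrK _)) ->; ring.
have gzX n : g (z ^+ n)%g = n%:R.
  elim: n => [|n IHn]; first by rewrite expg0 g1.
  by rewrite expgS gM IHn gz za fz !mul0r !addr0 mulrS.
have nat1 (k : 'F_p) : 1 *+ k = k by rewrite natr_Zp.
have [s0 [sa sb sc]] := onto u v w.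
have [[ka kb kc] kf kh] := pow w12 (u' - f s0 : 'F_p) (And3 wa wb wc).
have [[la lb lc] lf lh] := pow w23 (v' - h s0 : 'F_p) (And3 va vb vc).
set k := (w12 ^+ _)%g in ka kb kc kf kh; set l := (w23 ^+ _)%g in la lb lc lf lh.
rewrite fw nat1 in kf; rewrite hw mul0rn in kh.
rewrite fv mul0rn in lf; rewrite hv nat1 in lh.
pose s1 := (s0 * k * l)%g.
have [[ma mb mc] mf mh] := pow z (w' - g s1 : 'F_p) (And3 za zb zc).
have mg := gzX (w' - g s1 : 'F_p); rewrite natr_Zp in mg.
set m := (z ^+ _)%g in ma mb mc mf mh mg.
rewrite fz mul0rn in mf; rewrite hz mul0rn in mh.
exists (s1 * m)%g; rewrite gM mh mc mg mulr0 mulr0 !addr0; split; split.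
- by rewrite !aM ma ka la sa !addr0.
- by rewrite !bM mb kb lb sb !addr0.
- by rewrite !cM mc kc lc sc !addr0.
- by rewrite !fM mf kf lf mb kb lb !mulr0 !addr0; ring.
- by rewrite !hM mh kh lh mc kc lc !mulr0 !addr0; ring.
- by ring.
Qed.

(** * Infinity of local and global fields *)

Lemma infinite_of_morph (E F : fieldType) (f : {rmorphism E -> F}) :
  (exists u : nat -> E, injective u) -> exists u : nat -> F, injective u.
Proof.
by move=> [u uI]; exists (f \o u); apply: inj_comp => //; apply: fmorph_inj.
Qed.

Lemma local_or_global_infinite (K : fieldType) :
  local_field K \/ global_field K -> exists u : nat -> K, injective u.
Proof.
case=> [[[v [dv _ _]]|[R [|] [f _]]]|[[L [f _]]|[F [L [f _]]]]].
- have ex (n : nat) : exists x, v x = n%:Z.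
    by have [x _ xE] := valuation_surj dv n; exists x.
  have [u uE] := boolp.choice ex; exists u => m n.
  by move=> /(congr1 v); rewrite !uE => -[].
- apply: (infinite_of_morph f); exists (fun n => n%:R) => m n /eqP.
  by rewrite eqr_nat => /eqP.
- apply: (infinite_of_morph f); exists (fun n => n%:R) => m n /eqP.
  by rewrite eqr_nat => /eqP.
- apply: (infinite_of_morph f); apply: (infinite_of_morph (in_alg L)).
  by exists (fun n => n%:R) => m n /eqP; rewrite eqr_nat => /eqP.
- apply: (infinite_of_morph f); apply: (infinite_of_morph (in_alg L)).
  exists (fun n => tofrac ('X^n : {poly F})) => m n /eqP.
  rewrite tofrac_eq => /eqP /(congr1 (fun q : {poly F} => size q)).
  by rewrite !size_polyXn => -[].
Qed.

(** * Kummer characters and the embedding problem *)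

Lemma cup_eq0 (p : nat) (G : topGroupType) (f g : H1 p G) : cup f g = 0 ->
  exists2 h : G -> 'F_p, continuous_cochain h &
    forall s t, h t - h (s * t)%g + h s = f s * g t.
Proof.
have pi0 : (\pi_(Quotient.quot (@B2 p G)) 0)%qT = 0 by rewrite raddf0.
rewrite /cup -[X in _ = X]pi0 => /eqP.
rewrite -Quotient.idealrBE subr0 => /asboolP[h ch hE]; exists h => // s t.
exact/esym/(congr1 (fun c : G * G -> 'F_p => c (s, t)) hE).
Qed.

Section Embedding.
Variables (p : nat) (K Ks : fieldType) (zeta : K) (iota : {rmorphism K -> Ks}).
Hypotheses (p_prime : prime p) (zetaP : p.-primitive_root zeta).
Hypothesis sepK : separable_closure iota.
Local Notation G := (absgal iota).
Local Notation om := (om iota zeta).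
Local Notation chi a := (kummer_char p iota zeta a).

Lemma locally_constant1 (h : G -> 'F_p) : continuous_cochain h ->
  exists e : seq Ks, forall t : G, {in e, (t : Ks -> Ks) =1 id} -> h t = h 1%g.
Proof.
by move=> /continuous_discrete /(_ 1%g) /nbhs_krullP[e eP]; exists e => t te; apply: eP.
Qed.

Lemma kummer_additive a : additive_char (chi a).
Proof. by case: (H1P (chi a)). Qed.

Lemma kummer_root_act a r (s : G) :
  a != 0 -> r ^+ p = iota a -> s r = om (chi a s) * r.
Proof. by move=> a0 ra; apply: (kummer_charP sepK zetaP p_prime a0 ra). Qed.

Lemma pth_root_neq0 a r : a != 0 -> r ^+ p = iota a -> r != 0.
Proof.
move=> a0 ra; have : iota a != 0 by rewrite fmorph_eq0.
by rewrite -ra expf_eq0 (prime_gt0 p_prime).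
Qed.

(** If the combination of characters vanishes, the corresponding product of
    [p]-th roots is fixed by [G], hence lies in [K]. *)
Lemma kummer_independent n (u : 'I_n -> K) (k : 'I_n -> 'F_p) :
  (forall i, u i != 0) -> free_mod_powers p u ->
  (forall s : G, \sum_i k i * chi (u i) s = 0) -> forall i, k i = 0.
Proof.
move=> u0 free_u sum0; apply: free_u.
have [r rE] := boolp.choice (fun i => pth_root sepK zetaP (iota (u i))).
have [d dE] : exists d, \prod_i r i ^+ k i = iota d.
  apply: (fixed_by_absgal sepK) => s; rewrite rmorph_prod /=.
  transitivity (om (\sum_i k i * chi (u i) s) * \prod_i r i ^+ k i).
    rewrite (big_morph om (omD iota p_prime zetaP) (om0 iota p_prime zetaP)) -big_split /=.
    apply: eq_bigr => i _; rewrite rmorphXn /= (kummer_root_act s (u0 i) (rE i)) exprMn.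
    by rewrite -(omMn iota p_prime zetaP) natr_Zp mulrC [_ * k i]mulrC mulrC.
  by rewrite sum0 om0 // mul1r.
exists d.
  rewrite -(fmorph_eq0 iota) -dE; apply/prodf_neq0 => i _.
  by rewrite expf_neq0 // (pth_root_neq0 (u0 i) (rE i)).
apply: (fmorph_inj iota); rewrite rmorph_prod rmorphXn /= -dE -prodrXl.
by apply: eq_bigr => i _; rewrite rmorphXn /= -rE exprAC.
Qed.

Variables (a b c : K).
Hypotheses (a0 : a != 0) (b0 : b != 0) (c0 : c != 0).
Hypothesis free_abc : free_mod_powers p (tnth [tuple a; b; c]).

Lemma kummer_onto3 (u v w : 'F_p) : exists s : G, [/\ chi a s = u, chi b s = v & chi c s = w].
Proof.
have [i|k sum0|s sE] := @independent_chars_onto _ _ iota p 3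
  (fun i => chi (tnth [tuple a; b; c] i)) _ _ (tnth [tuple u; v; w]).
- exact: kummer_additive.
- apply: kummer_independent sum0 => // i.
  by case: i => [[|[|[|?]]] Hi] //.
exists s; have := (sE (inord 0), sE (inord 1), sE (inord 2)).
by rewrite /tnth !inordK //= => -[[-> ->] ->].
Qed.

Hypotheses (cup_ab : cup (chi a) (chi b) = 0) (cup_bc : cup (chi b) (chi c) = 0).
Hypothesis infK : exists u : nat -> K, injective u.

(** The cochains of [massey_cochains], rearranged as the entries of a
    unitriangular matrix, form a homomorphism from [G] onto the unitriangular
    group whose kernel is the stabilizer of the six [p]-th roots in [vs]. *)
Theorem unitriangular_embedding : exists L : splittingFieldType K,
  [/\ galois 1 {:L}, 'Gal({:L} / 1) \isog unitriangular 4 p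
    & exists x y z : L, [/\ x ^+ p = a%:A, y ^+ p = b%:A & z ^+ p = c%:A]].
Proof.
have [ra raE] := pth_root sepK zetaP (iota a).
have [rb rbE] := pth_root sepK zetaP (iota b).
have [rc rcE] := pth_root sepK zetaP (iota c).
have [[ra0 rb0] rc0] := (pth_root_neq0 a0 raE, pth_root_neq0 b0 rbE, pth_root_neq0 c0 rcE).
have raP s := kummer_root_act s a0 raE.
have rbP s := kummer_root_act s b0 rbE.
have rcP s := kummer_root_act s c0 rcE.
have [[aM bM] cM] := (kummer_additive a, kummer_additive b, kummer_additive c).
have chi_eq d r (s t : G) : d != 0 -> r ^+ p = iota d -> s r = t r -> chi d s = chi d t.
  move=> d0 rE; rewrite !(kummer_root_act _ d0 rE) => /(mulIf (pth_root_neq0 d0 rE)).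
  exact: om_inj.
have [x [xa xb xc]] := kummer_onto3 1 0 0.
have [y [ya yb yc]] := kummer_onto3 0 0 1.
have [f1 cf1 f1P] := cup_eq0 cup_ab; have [e1 e1P] := locally_constant1 cf1.
have [f2 cf2 f2P] := cup_eq0 cup_bc; have [e2 e2P] := locally_constant1 cf2.
have [alpha [alpha0 alpha_fix alpha_norm]] :=
  norm_of_cup sepK p_prime zetaP aM bM rb0 rbP f1P e1P xa xb.
(* The cup product is anticommutative: adding the coboundary of the product of
   the two characters exchanges the factors. *)
pose f3 s := - (chi b s * chi c s + f2 s).
have [||gamma [gamma0 gamma_fix gamma_norm]] :=
  @norm_of_cup _ _ iota sepK p zeta p_prime zetaP _ _ f3 rb y (rb :: rc :: e2)
    cM bM rb0 rbP _ _ yc yb.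
- move=> s t; rewrite /f3 bM cM.
  have -> : f2 (s * t)%g = f2 t + f2 s - chi b s * chi c t by rewrite -f2P; ring.
  by ring.
- move=> t te; rewrite /f3 e2P; last by move=> z ze; apply: te; rewrite !inE ze !orbT.
  by rewrite (chi_eq b rb t 1%g) ?(chi_eq c rc t 1%g) // te ?inE ?eqxx ?orbT.
pose us := [:: ra; rc].
have us_ac (s t : G) : {in us, (s : Ks -> Ks) =1 t} -> chi a s = chi a t /\ chi c s = chi c t.
  by move=> st; split; [apply: (chi_eq a ra)|apply: (chi_eq c rc)]; rewrite ?st ?inE ?eqxx ?orbT.
have [e [e0 e_ac exy]] := norm_quotient sepK p_prime aM cM rb0 xa xc ya yc alpha0 gamma0
  alpha_fix gamma_fix alpha_norm gamma_norm us_ac.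
have [phi [psi [g [rA [rC [rd [phiM psiM gM [rA0 rC0 rd0] act]]]]]]] :=
  massey_cochains sepK p_prime zetaP aM cM rb0 rbP xa xc ya yc alpha0 gamma0
    alpha_fix gamma_fix alpha_norm gamma_norm us_ac e0 e_ac exy.
(* The cocycle relations of [phi] and [g] have the characters on the wrong side
   for a product of matrices; adding products of cochains moves them. *)
pose f s := chi a s * chi b s - phi s.
pose g' s := chi a s * psi s - g s.
have fM s t : f (s * t)%g = f s + f t + chi a s * chi b t.
  by rewrite /f aM bM phiM; ring.
have g'M s t : g' (s * t)%g = g' s + g' t + chi a s * psi t + f s * chi c t.
  by rewrite /g' /f aM psiM gM; ring.
pose rho s := u4 (chi a s) (chi b s) (chi c s) (f s) (psi s) (g' s).
pose vs := [:: ra; rb; rc; rA; rC; rd].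
have rhoM s t : rho (s * t)%g = (rho s * rho t)%g.
  by rewrite /rho u4M aM bM cM fM psiM g'M.
have rho_onto m : m \in unitriangular 4 p -> exists s, rho s = m.
  move=> /u4P[u [v [w [u' [v' [w' ->]]]]]].
  have [s [[su sv sw] [su' sv' sw']]] :=
    u4_entries_onto p_prime aM bM cM fM psiM g'M kummer_onto3 u v w u' v' w'.
  by exists s; rewrite /rho su sv sw su' sv' sw'.
have om1 (r : Ks) (u : 'F_p) : r != 0 -> om u * r = r -> u = 0.
  move=> r0 ur; apply: (@om_inj _ _ iota _ _ p_prime zetaP); apply: (mulIf r0).
  by rewrite ur om0 // mul1r.
have rho_ker s : rho s = 1%g <-> {in vs, (s : Ks -> Ks) =1 id}.
  split=> [/u4_eq1[[sa sb sc] [sf spsi sg]]|fix_vs].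
    have sphi : phi s = 0 by apply/eqP; rewrite -oppr_eq0 -sf /f sa mul0r sub0r.
    have sg0 : g s = 0 by apply/eqP; rewrite -oppr_eq0 -sg /g' sa mul0r sub0r.
    have [sA sC sd] := act s sa sc; have om01 := om0 iota p_prime zetaP.
    move=> r; rewrite !inE.
    case/orP=> [/eqP->|/orP[/eqP->|/orP[/eqP->|/orP[/eqP->|/orP[/eqP->|/eqP->]]]]].
    - by rewrite raP sa om01 mul1r.
    - by rewrite rbP sb om01 mul1r.
    - by rewrite rcP sc om01 mul1r.
    - by rewrite sA sphi om01 mul1r.
    - by rewrite sC spsi om01 mul1r.
    - by rewrite sd sg0 om01 mul1r.
  have fixv r : r \in vs -> s r = r by apply: fix_vs.
  have sa : chi a s = 0 by apply: (om1 ra); rewrite -?raP ?fixv ?inE ?eqxx ?orbT.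
  have sb : chi b s = 0 by apply: (om1 rb); rewrite -?rbP ?fixv ?inE ?eqxx ?orbT.
  have sc : chi c s = 0 by apply: (om1 rc); rewrite -?rcP ?fixv ?inE ?eqxx ?orbT.
  have [sA sC sd] := act s sa sc.
  have sphi : phi s = 0 by apply: (om1 rA); rewrite -?sA ?fixv ?inE ?eqxx ?orbT.
  have spsi : psi s = 0 by apply: (om1 rC); rewrite -?sC ?fixv ?inE ?eqxx ?orbT.
  have sg : g s = 0 by apply: (om1 rd); rewrite -?sd ?fixv ?inE ?eqxx ?orbT.
  by apply/u4_eq1; rewrite /f /g' sa sphi sg !mul0r subrr.
have [L [galL isoL [j jK j_onto]]] := @realization _ _ iota sepK _
  (unitriangular_group 4 p) rho vs infK rhoM (fun s => u4_in _ _ _ _ _ _) rho_onto rho_ker.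
exists L; split=> //.
have root_in d r : r ^+ p = iota d -> r \in vs -> exists z : L, z ^+ p = d%:A.
  move=> rE /j_onto[z zE]; exists z; apply: (fmorph_inj j).
  by rewrite rmorphXn /= zE rE jK.
have [z1 z1E] := root_in a ra raE (mem_head _ _).
have [z2 z2E] : exists z : L, z ^+ p = b%:A by apply: (root_in b rb); rewrite ?inE ?eqxx ?orbT.
have [z3 z3E] : exists z : L, z ^+ p = c%:A by apply: (root_in c rc); rewrite ?inE ?eqxx ?orbT.
by exists z1, z2, z3.
Qed.

End Embedding.

Theorem corollary1p4 (p : nat) (K : fieldType) (zeta : K)
    (Ks : fieldType) (iota : {rmorphism K -> Ks}) (a b c : K) :
  prime p ->
  local_field K \/ global_field K ->
  p.-primitive_root zeta ->
  separable_closure iota ->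
  a != 0 -> b != 0 -> c != 0 ->
  free_mod_powers p (tnth [tuple a; b; c]) ->
  cup (kummer_char p iota zeta a) (kummer_char p iota zeta b) = 0 ->
  cup (kummer_char p iota zeta b) (kummer_char p iota zeta c) = 0 ->
  exists L : splittingFieldType K,
    [/\ galois 1 {:L},
        'Gal({:L} / 1) \isog unitriangular 4 p
      & exists x y z : L,
          [/\ x ^+ p = a%:A, y ^+ p = b%:A & z ^+ p = c%:A]].
Proof.
move=> p_prime lgK zetaP sepK a0 b0 c0 free_abc cup_ab cup_bc.
have infK := local_or_global_infinite lgK.
exact: (unitriangular_embedding p_prime zetaP sepK a0 b0 c0 free_abc cup_ab cup_bc infK).
Qed.
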